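(* Let $s\in(0,1)$ and let $E$ be a free boundary $s$-minimal surface in $\Omega$ of class $C^0$. Then there are no points on $\partial E\cap\partial\Omega$ at which $E$ sticks to $\Omega$ from outside.
   Context: $A^c=\mathbb{R}^n\setminus A$. For $s\in(0,1)$, an open set $\Omega\subset\mathbb{R}^n$ and a measurable set $E\subset\mathbb{R}^n$, the $s$-fractional perimeter is $$\operatorname{Per}_s(E;\Omega)=c_{n,s}\left(\int_{E^c\cap\Omega}\int_{E\cap\Omega}+\int_{E\cap\Omega}\int_{E^c\cap\Omega^c}+\int_{E\cap\Omega^c}\int_{E^c\cap\Omega}\right)\frac{dx\,dy}{|x-y|^{n+s}},$$ with $c_{n,s}=\frac{2^{2+2s}\Gamma\left(\frac{n+s}2\right)}{\pi^{n/2}\Gamma(2-s)}s(1-s)$. Let $\Omega$ have $C^1$ boundary. $\partial E$ (or, with abuse of notation, $E$) is a free boundary $s$-minimal (hyper)surface in $\Omega$ if for every $\mathcal{X}\in C^\infty_c(\mathbb{R}^n,\mathbb{R}^n)$ with $\mathcal{X}(x)\in T_x(\partial\Omega)$ for all $x\in\partial\Omega$ one has $\frac{d}{dt}\big|_{t=0}\operatorname{Per}_s(\Phi_t(E);\Omega)=0$, where $\Phi_t$ is the flow of $\mathcal{X}$ ($\partial_t\Phi_t=\mathcal{X}\circ\Phi_t$, $\Phi_0=\mathrm{id}$). Stickiness from outside: let $E$ and $\Omega$ be open sets of $\mathbb{R}^n$ of class $C^0$ (locally subgraphs, in some direction, of continuous functions near boundary points) and let $x\in\partial E\cap\partial\Omega$.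 The set $E$ sticks to $\Omega$ from outside at $x$ if there exists $\rho>0$ such that either $\Omega\cap B_\rho(x)\subset E$ and $\Omega^c\cap B_\rho(x)\cap E\ne\varnothing$, or $\Omega\cap B_\rho(x)\subset E^c$ and $\Omega^c\cap B_\rho(x)\cap E^c\ne\varnothing$.
   Formalization: Sticking at x is required for all small ρ, not just some ρ, and in the second alternative Ω^c∩B_ρ(x) must meet the interior of E^c; read literally, Ω={1<|x|<2}, E={|x|>1} and Ω={|x|<1}, E={|x|>1} are counterexamples. *)

(* Defs.v *)
From HB Require Import structures.
From mathcomp Require Import all_boot all_order all_algebra.
From mathcomp Require Import all_classical all_reals all_analysis.

Set Implicit Arguments.
Unset Strict Implicit.
Unset Printing Implicit Defensive.

Import Order.TTheory GRing.Theory Num.Theory.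
Import numFieldNormedType.Exports.

Local Open Scope classical_set_scope.
Local Open Scope ring_scope.

(* Points of R^n are row vectors 'rV[R]_n, whose topology in the library comes
   from the sup norm; lengths and balls below are always Euclidean. *)

Section measurable_rV.
Context {R : realType}.
Variable n : nat.

Let coord (i : 'I_n) (x : 'rV[R]_n) : measurableTypeR R := x ord0 i.

Let rV_measurable0 : g_sigma_preimage coord set0.
Proof. exact: sigma_algebra0. Qed.

Let rV_measurableC A :
  g_sigma_preimage coord A -> g_sigma_preimage coord (~` A).
Proof. exact: sigma_algebraC. Qed.

Let rV_measurable_bigcup (F : (set 'rV[R]_n)^nat) :
  (forall i, g_sigma_preimage coord (F i)) ->
  g_sigma_preimage coord (\bigcup_i (F i)).
Proof. exact: sigma_algebra_bigcup. Qed.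

(* The product sigma-algebra, i.e. the Borel sets of R^n. *)
HB.instance Definition _ := @isMeasurable.Build default_measure_display
  'rV[R]_n (g_sigma_preimage coord)
  rV_measurable0 rV_measurableC rV_measurable_bigcup.

End measurable_rV.

Lemma measurable_coord_rV (R : realType) n (i : 'I_n) :
  measurable_fun [set: 'rV[R]_n]
    (fun x : 'rV[R]_n => x ord0 i : measurableTypeR R).
Proof.
move=> _ Y mY; rewrite setTI; apply: sub_sigma_algebra => /=.
rewrite -bigcup_seq/=; exists i => /=; first by rewrite mem_index_enum.
by exists Y => //; rewrite setTI.
Qed.

Lemma measurable_fun_rV d (T : measurableType d) (R : realType) n
    (f : T -> 'rV[R]_n) :
  (forall i, measurable_fun [set: T]
     (fun t => f t ord0 i : measurableTypeR R)) ->
  measurable_fun [set: T] f.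
Proof.
move=> mf _ A; rewrite setTI.
pose G : set (set 'rV[R]_n) := [set B | measurable (f @^-1` B)].
suff : measurable `<=` G by apply.
apply: smallest_sub.
  split => [|B mB|F mF]; rewrite /G /=.
  - by rewrite preimage_set0.
  - by rewrite setTD preimage_setC; exact: measurableC.
  - by rewrite preimage_bigcup; exact: bigcupT_measurable.
rewrite -bigcup_seq/= => B [i _ [C mC <-]].
by rewrite /G /= setTI -[X in measurable X]setTI; exact: mf.
Qed.

Section lebesgue_measure_rV.
Context {R : realType}.

Definition rV_cons n (p : measurableTypeR R * 'rV[R]_n) : 'rV[R]_n.+1 :=
  \row_i if unlift ord0 i is Some j then p.2 ord0 j else p.1.

Definition rV_uncons n (x : 'rV[R]_n.+1) : measurableTypeR R * 'rV[R]_n :=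
  (x ord0 ord0, \row_j x ord0 (lift ord0 j)).

Lemma rV_consE0 n p : @rV_cons n p ord0 ord0 = p.1.
Proof. by rewrite mxE unlift_none. Qed.

Lemma rV_consES n p (j : 'I_n) : @rV_cons n p ord0 (lift ord0 j) = p.2 ord0 j.
Proof. by rewrite mxE liftK. Qed.

Lemma rV_consK n : cancel (@rV_cons n) (@rV_uncons n).
Proof.
move=> [a y]; rewrite /rV_uncons rV_consE0; congr (_, _).
by apply/rowP => j; rewrite mxE rV_consES.
Qed.

Lemma measurable_rV_cons n : measurable_fun setT (@rV_cons n).
Proof.
apply: measurable_fun_rV => i; rewrite /rV_cons.
under eq_fun do rewrite mxE.
case: (unlift ord0 i) => [j|]; last exact: measurable_fst.
exact: (measurableT_comp (measurable_coord_rV j) measurable_snd).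
Qed.

Lemma measurable_rV_uncons n : measurable_fun setT (@rV_uncons n).
Proof.
apply/measurable_fun_pairP; split; first exact: measurable_coord_rV.
apply: measurable_fun_rV => j; rewrite /comp /=.
by under eq_fun do rewrite mxE; exact: measurable_coord_rV.
Qed.

Section step.
Variables (n : nat) (mu : {sigma_finite_measure set 'rV[R]_n -> \bar R}).

Definition lebesgue_step : set 'rV[R]_n.+1 -> \bar R :=
  pushforward (@lebesgue_measure R \x mu)%E (@rV_cons n).

Let step0 : lebesgue_step set0 = 0%E.
Proof. by rewrite /lebesgue_step /pushforward preimage_set0 measure0. Qed.

Let step_ge0 A : (0 <= lebesgue_step A)%E.
Proof. by rewrite /lebesgue_step /pushforward measure_ge0. Qed.

Let step_sigma_additive : semi_sigma_additive lebesgue_step.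
Proof.
move=> F mF tF mUF; rewrite /lebesgue_step /pushforward preimage_bigcup.
have mcons A : measurable A -> measurable (@rV_cons n @^-1` A).
  by move=> mA; rewrite -[X in measurable X]setTI; exact: measurable_rV_cons.
apply: measure_semi_sigma_additive.
- by move=> k; exact: mcons.
- apply/trivIsetP => /= i j _ _ ij; rewrite -preimage_setI.
  by move/trivIsetP : tF => /(_ _ _ _ _ ij) ->//; rewrite preimage_set0.
- by rewrite -preimage_bigcup; exact: mcons.
Qed.

HB.instance Definition _ := isMeasure.Build _ _ _ lebesgue_step
  step0 step_ge0 step_sigma_additive.

Let step_sigma_finite : sigma_finite setT lebesgue_step.
Proof.
have /sigma_finiteP[F [TF ndF Foo]] := sigma_finiteT (@lebesgue_measure R).
have /sigma_finiteP[G [TG ndG Goo]] := sigma_finiteT mu.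
exists (fun k => @rV_uncons n @^-1` (F k `*` G k)).
  rewrite -preimage_bigcup (_ : \bigcup_k _ = setT) ?preimage_setT//.
  apply/seteqP; split => // -[x y] _.
  have [i _ Fx] : (\bigcup_k F k) x by rewrite -TF.
  have [j _ Gy] : (\bigcup_k G k) y by rewrite -TG.
  exists (maxn i j) => //; split => /=.
  - by move: x Fx; exact/subsetPset/ndF/leq_maxl.
  - by move: y Gy; exact/subsetPset/ndG/leq_maxr.
move=> k; have [mF Fk] := Foo k; have [mG Gk] := Goo k; split.
  rewrite -[X in measurable X]setTI; apply: measurable_rV_uncons => //.
  exact: measurableX.
rewrite /lebesgue_step /pushforward (_ : _ @^-1` _ = F k `*` G k).
  by rewrite product_measure1E// lte_mul_pinfty// ge0_fin_numE.
rewrite -comp_preimage (_ : _ \o _ = id) ?preimage_id//.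
by apply/funext => p; exact: rV_consK.
Qed.

HB.instance Definition _ := Measure_isSigmaFinite.Build _ _ _ lebesgue_step
  step_sigma_finite.

End step.

(* n-dimensional Lebesgue measure, as an iterated product (on the one-point
   space R^0 it is the unit mass). *)
Fixpoint lebesgue_rV n : {sigma_finite_measure set 'rV[R]_n -> \bar R} :=
  match n with
  | 0 => dirac (0 : 'rV[R]_0)
  | n'.+1 => lebesgue_step (lebesgue_rV n')
  end.

End lebesgue_measure_rV.

Section euclidean.
Context {R : realType} {n : nat}.
Implicit Types x y : 'rV[R]_n.

Definition dot x y : R := \sum_i x ord0 i * y ord0 i.

Definition enorm x : R := Num.sqrt (dot x x).

Definition eball x (r : R) : set 'rV[R]_n := [set y | enorm (y - x) < r].

End euclidean.

Definition boundary {T : topologicalType} (A : set T) : set T :=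
  closure A `\` A°.

(* In finite dimension, f is C^(k+1) iff it is differentiable with all its
   directional derivatives of class C^k. *)
Fixpoint class_C {R : realType} {U V : normedModType R} (k : nat)
    (f : U -> V) : Prop :=
  if k is k'.+1 then
    (forall x, differentiable f x) /\ (forall v, class_C k' ('D_v f))
  else continuous f.

Section sets_and_flows.
Context {R : realType} {n : nat}.
Implicit Types (A Omega E : set 'rV[R]_n) (X : 'rV[R]_n -> 'rV[R]_n).

(* Near each of its boundary points A is the strict subgraph, in the direction
   of a unit vector e, of a C^k function of the component orthogonal to e. *)
Definition set_of_class k A : Prop :=
  forall x : 'rV[R]_n, boundary A x ->
  exists (e : 'rV[R]_n) (g : 'rV[R]_n -> R) (r : R),
    [/\ dot e e = 1, class_C k g, 0 < r &
      forall y, eball x r y -> (A y <-> dot y e < g (y - dot y e *: e))].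

(* T_x S, as the set of velocities at x of curves lying in S. *)
Definition tangent_space (S : set 'rV[R]_n) (x : 'rV[R]_n) : set 'rV[R]_n :=
  [set v | exists c : R -> 'rV[R]_n,
    [/\ c 0 = x, \forall t \near (0 : R), S (c t) &
      is_derive (0 : R) (1 : R) c v]].

Definition smooth_compactly_supported X : Prop :=
  (forall k, class_C k X) /\ compact (closure [set x | X x != 0]).

Definition is_flow X (Phi : R -> 'rV[R]_n -> 'rV[R]_n) : Prop :=
  (forall x, Phi 0 x = x) /\
  (forall t x, is_derive t (1 : R) (fun u : R => Phi u x) (X (Phi t x))).

End sets_and_flows.

Section fractional_perimeter.
Context {R : realType} {n : nat}.
Implicit Types (A B Omega E : set 'rV[R]_n) (s : R).

Definition Gamma (a : R) : R :=
  \int[@lebesgue_measure R]_(u in `]0, +oo[) (u `^ (a - 1) * expR (- u)).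

Definition c_ns s : R :=
  2 `^ (2 + 2 * s) * Gamma ((n%:R + s) / 2)
  / (pi `^ (n%:R / 2) * Gamma (2 - s)) * s * (1 - s).

Definition interaction s A B : \bar R :=
  (\int[lebesgue_rV n]_(x in A) \int[lebesgue_rV n]_(y in B)
     ((enorm (x - y) `^ (n%:R + s))^-1)%:E)%E.

Definition Per s E Omega : \bar R :=
  ((c_ns s)%:E *
   (interaction s (~` E `&` Omega) (E `&` Omega)
    + interaction s (E `&` Omega) (~` E `&` ~` Omega)
    + interaction s (E `&` ~` Omega) (~` E `&` Omega)))%E.

(* Per is extended-real valued; having derivative 0 at t = 0 includes its being
   finite for t near 0. *)
Definition free_boundary_minimal s E Omega : Prop :=
  forall X Phi,
    smooth_compactly_supported X ->
    (forall x, boundary Omega x -> tangent_space (boundary Omega) x (X x)) ->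
    is_flow X Phi ->
    (\forall t \near (0 : R), Per s (Phi t @` E) Omega \is a fin_num) /\
    is_derive (0 : R) (1 : R) (fun t : R => fine (Per s (Phi t @` E) Omega)) 0.

(* Sticking is local at x, so the condition is asked of all small balls.  With
   one ball of arbitrary radius, for Omega = {1 < |x| < 2} the set E = {|x| > 1}
   would stick at every x with |x| = 1, only because a large ball centered at x
   reaches {|x| >= 2}.
   In the second alternative the set lying outside Omega is the open set
   (~` E)°, as E is open in the first one.  With ~` E itself the intersection
   would always contain x, and E = {|x| > 1} would stick to Omega = {|x| < 1}. *)
Definition sticks_from_outside E Omega (x : 'rV[R]_n) : Prop :=
  exists2 rho0 : R, 0 < rho0 & forall rho, 0 < rho < rho0 ->
    (Omega `&` eball x rho `<=` E /\
     ~` Omega `&` eball x rho `&` E !=set0) \/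
    (Omega `&` eball x rho `<=` ~` E /\
     ~` Omega `&` eball x rho `&` (~` E)° !=set0).

End fractional_perimeter.

(* Main.v *)
(* Suppose that E contains Omega near x (otherwise replace E by its complement,
   which has the same perimeter).  The regularity of the two boundaries yields
   points y of the boundary of E, arbitrarily close to x, in the interior of
   the complement of Omega.  Near such a y the set E is the subgraph of a
   continuous function in a direction e; push it along a bump field phi e
   supported in a ball around y which does not meet Omega.  This field is
   admissible, and at time t > 0 it has added to E a set D with |D| >= c t.
   Adding D changes the perimeter by the interaction of D with Omega \ E minus
   the interaction of D with Omega and E.  The set Omega \ E stays away from x,
   so the first is at most M |D|; all of Omega near x is in E, so by the
   interior cone condition of Omega the second is at least c r^(-s) |D| when D
   is at distance at most r from x.  For small r the perimeter drops at a
   linear rate in t, against stationarity.  Comparing E with a larger set,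
   instead of using an Euler-Lagrange equation, is what makes a merely
   continuous boundary of E enough. *)
Require Import Defs.
From HB Require Import structures.
From mathcomp Require Import all_boot all_order all_algebra.
From mathcomp Require Import all_classical all_reals all_analysis.
From mathcomp Require Import measurable_realfun.
From mathcomp Require Import ring lra.
Import Order.TTheory GRing.Theory Num.Theory.
Import numFieldNormedType.Exports.
Local Open Scope classical_set_scope.
Local Open Scope ring_scope.

Set Implicit Arguments.
Unset Strict Implicit.

(** * Positivity of the constant c_{n,s} *)

Lemma expn_le_expR (R : realType) (m : nat) (u : R) : 0 <= u ->
  u ^+ m.+1 <= m.+1%:R ^+ m.+1 * expR u.
Proof.
move=> u0; have m0 : (0 : R) < m.+1%:R by rewrite ltr0n.
have -> : expR u = expR (u / m.+1%:R) ^+ m.+1.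
  by rewrite -expRM_natr -mulrA mulVf ?mulr1// gt_eqF.
rewrite -exprMn; apply: lerXn2r; rewrite ?nnegrE// ?mulr_ge0 ?expR_ge0 ?ler0n//.
by rewrite -ler_pdivrMl// [_^-1 * u]mulrC; apply: le_trans (expR_ge1Dx _); rewrite lerDr.
Qed.

(* [u^a / (1 + u^a)] is bounded and increasing, with derivative
   [a u^(a-1) / (1 + u^a)^2], which dominates the integrand of [Gamma a]. *)
Lemma Gamma_integrand_dominated (R : realType) (a : R) : 0 < a ->
  exists2 C : R, 0 < C & forall u, 0 < u ->
    u `^ (a - 1) * expR (- u) <= C * (a * u `^ (a - 1) / (1 + u `^ a) ^+ 2).
Proof.
move=> a0.
have [m ma] : exists m, 2 * a <= m.+1%:R.
  exists (Num.trunc (2 * a)); apply/ltW/truncnS_gt.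
have N0 : (1 : R) <= m.+1%:R ^+ m.+1 by apply: exprn_ege1; rewrite ler1n.
set N : R := m.+1%:R ^+ m.+1 in N0.
exists (4 * N / a) => [|u u0]; first by rewrite divr_gt0//; nra.
have p0 : 0 < u `^ a by exact: powR_gt0.
rewrite [leRHS](_ : _ = u `^ (a - 1) * (4 * N / (1 + u `^ a) ^+ 2)); last first.
  field; rewrite !gt_eqF//; lra.
apply: ler_wpM2l; first exact: powR_ge0.
rewrite expRN ler_pdivlMr ?exprn_gt0//; last by lra.
rewrite mulrC ler_pdivrMr ?expR_gt0//.
have [u1|u1] := leP u 1.
  have : u `^ a <= 1.
    have one : 1 `^ a = 1 :> R by rewrite powR1.
    by rewrite -[leRHS]one; apply: ge0_ler_powR => //; rewrite ?nnegrE//; exact: ltW.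
  have : 1 <= expR u by rewrite -expR0 ler_expR ltW.
  move=> e1 p1; apply: (@le_trans _ _ (4 * 1)); last by nra.
  by rewrite expr2; nra.
have p1 : 1 <= u `^ a by rewrite -(powRr0 u) ler_powR ?ltW.
apply: (@le_trans _ _ (4 * (u `^ a) ^+ 2)); first by rewrite !expr2; nra.
rewrite -mulrA ler_pM2l//; apply: le_trans (expn_le_expR m (ltW u0)).
rewrite -!powR_mulrn ?powR_ge0 ?(ltW u0)// -powRrM.
by apply: ler_powR; [exact: ltW|rewrite mulrC].
Qed.

Lemma Gamma_fin (R : realType) (a : R) : 0 < a ->
  (\int[@lebesgue_measure R]_(u in `]0%R, +oo[) (u `^ (a - 1) * expR (- u))%:E
    < +oo)%E.
Proof.
move=> a0; have [C C0 dom] := Gamma_integrand_dominated a0.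
pose f (u : R) := u `^ (a - 1) * expR (- u).
pose g (u : R) := C * (a * u `^ (a - 1) / (1 + u `^ a) ^+ 2).
pose G (u : R) := C * (1 - (1 + u `^ a)^-1).
have f0 u : 0 <= f u by rewrite mulr_ge0 ?powR_ge0 ?expR_ge0.
have p0 u : 0 < 1 + u `^ a by have := powR_ge0 u a; lra.
have dpow (u b : R) : 0 < u -> {for u, continuous (fun x : R => x `^ b)}.
  move=> u0; apply/differentiable_continuous/derivable1_diffP.
  by have [] := is_derive1_powR b u0.
have dG (u : R) : 0 < u -> is_derive u (1 : R) G (g u).
  move=> u0; have H := is_derive1_powR a u0.
  have H1 : is_derive u (1 : R) (fun x : R => 1 + x `^ a) (0 + a * u `^ (a - 1)).
    exact: is_deriveD.
  have H2 : is_derive u (1 : R) (fun x : R => (1 + x `^ a)^-1)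
     (- (1 + u `^ a) ^- 2 *: (0 + a * u `^ (a - 1))).
    by apply: is_deriveV => //; rewrite lt0r_neq0.
  have H3 : is_derive u (1 : R) (fun x : R => 1 - (1 + x `^ a)^-1)
     (0 - (- (1 + u `^ a) ^- 2 *: (0 + a * u `^ (a - 1)))) by exact: is_deriveB.
  have H4 : is_derive u (1 : R) G
     (C *: (0 - (- (1 + u `^ a) ^- 2 *: (0 + a * u `^ (a - 1))))) by exact: is_deriveZ.
  apply: is_derive_eq H4 _.
  by rewrite /g !add0r scaleNr opprK /GRing.scale/= [X in C * X]mulrC.
have cg u : 0 < u -> {for u, continuous g}.
  move=> u0; apply: cvgM; first exact: cvg_cst.
  apply: cvgM; first by apply: cvgM; [exact: cvg_cst|exact: dpow].
  apply: cvgV; first by rewrite gt_eqF// exprn_gt0.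
  have : {for u, continuous (fun x : R => 1 + x `^ a)}.
    by apply: cvgD; [exact: cvg_cst|exact: dpow].
  by move=> c; apply: (cvg_comp _ _ c (@exprn_continuous _ 2 _)).
have /measurable_EFinP mf : measurable_fun [set: R] f.
  apply: measurable_funM; first exact: measurable_powR.
  by apply: measurableT_comp => //; exact: measurable_funN.
pose F (k : nat) : set R := `[k.+2%:R^-1, k.+2%:R]%classic.
have F0 k u : F k u -> 0 < u.
  rewrite /F/= in_itv/= => /andP[+ _]; apply: lt_le_trans.
  by rewrite invr_gt0 ltr0n.
have FE : \bigcup_k F k = `]0, +oo[%classic.
  apply/seteqP; split=> u; first by move=> [k _ /F0 u0]; rewrite /= in_itv/= u0.
  rewrite /= in_itv/= andbT => u0.
  exists (Num.trunc (u + u^-1)) => //; rewrite /F/= in_itv/=.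
  have ui0 : 0 < u^-1 by rewrite invr_gt0.
  have := truncnS_gt (u + u^-1); set m := Num.trunc _ => H.
  have H' : u + u^-1 < m.+2%:R by rewrite -[m.+2]addn1 natrD; lra.
  apply/andP; split; last by lra.
  by rewrite -[leRHS]invrK lef_pV2 ?posrE ?invr_gt0 ?ltr0n//; lra.
have Fb k : (\int[@lebesgue_measure R]_(u in F k) (f u)%:E <= C%:E)%E.
  have k2 : (k.+2%:R^-1 : R) < k.+2%:R.
    by rewrite (@lt_trans _ _ 1)// ?invf_lt1 ?ltr1n ?ltr0n.
  apply: (@le_trans _ _ (\int[@lebesgue_measure R]_(u in F k) (g u)%:E)%E).
    apply: ge0_le_integral => //.
    - exact: measurable_itv.
    - by move=> u _; rewrite lee_fin.
    - exact: measurable_funTS.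
    - apply/measurable_EFinP; apply: subspace_continuous_measurable_fun.
        exact: measurable_itv.
      by apply: continuous_in_subspaceT => u /set_mem/F0; exact: cg.
    - by move=> u /F0 u0; rewrite lee_fin dom.
  rewrite (continuous_FTC2 k2 (F := G)).
  - rewrite -EFinB lee_fin /G.
    have pi u : 0 < (1 + u `^ a)^-1 by rewrite invr_gt0.
    have qi u : (1 + u `^ a)^-1 <= 1 by rewrite invf_le1// lerDl powR_ge0.
    have := pi k.+2%:R; have := qi k.+2%:R^-1; nra.
  - by apply: continuous_in_subspaceT => u /set_mem/F0; exact: cg.
  - split.
    + move=> u /subset_itv_oo_cc /F0 u0; by have [] := dG u u0.
    + apply: cvg_at_right_filter; apply/differentiable_continuous/derivable1_diffP.
      by have [] := dG (k.+2%:R^-1); rewrite ?invr_gt0 ?ltr0n.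
    + apply: cvg_at_left_filter; apply/differentiable_continuous/derivable1_diffP.
      by have [] := dG (k.+2%:R); rewrite ?ltr0n.
  - move=> u /subset_itv_oo_cc /F0 u0; have [_ <-] := dG u u0; exact: derive1E.
have ndF i j : (i <= j)%N -> F i `<=` F j.
  move=> ij u; rewrite /F/= !in_itv/= => /andP[ul ur].
  have ijR : (i.+2%:R : R) <= j.+2%:R by rewrite ler_nat !ltnS.
  rewrite (le_trans ur ijR) andbT (le_trans _ ul)//.
  by rewrite lef_pV2 ?posrE ?ltr0n.
have lim : (\int[lebesgue_measure]_(u in F k) (f u)%:E)%E @[k --> \oo] -->
    (\int[lebesgue_measure]_(u in \bigcup_k F k) (f u)%:E)%E.
  apply: ge0_nondecreasing_set_cvg_integral.
  - by move=> i j ij; apply/subsetPset; exact: ndF.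
  - by move=> k; exact: measurable_itv.
  - by move=> k; exact: measurable_funTS.
  - by move=> k u _; rewrite lee_fin.
rewrite -FE -(cvg_lim _ lim)//.
apply: le_lt_trans (ltry C); apply: lime_le; last exact: nearW.
exact: cvgP lim.
Qed.

Lemma Gamma_gt0 (R : realType) (a : R) : 0 < a -> 0 < Gamma a.
Proof.
move=> a0; rewrite /Gamma /Rintegral fine_gt0// (Gamma_fin a0) andbT.
have /measurable_EFinP mf : measurable_fun [set: R] (fun u : R => u `^ (a - 1) * expR (- u)).
  apply: measurable_funM; first exact: measurable_powR.
  by apply: measurableT_comp => //; exact: measurable_funN.
have sub : `[1, 2] `<=` (`]0, +oo[ : set R).
  by move=> u; rewrite /= !in_itv/= => /andP[u1 _]; rewrite andbT; lra.
apply: (@lt_le_trans _ _ (\int[@lebesgue_measure R]_(u in `[1%R, 2%R])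
    (u `^ (a - 1) * expR (- u))%:E)%E); last first.
  apply: ge0_subset_integral => //; first exact: measurable_funTS.
  by move=> u _; rewrite lee_fin mulr_ge0 ?powR_ge0 ?expR_ge0.
apply: (@lt_le_trans _ _ (\int[@lebesgue_measure R]_(u in `[1%R, 2%R])
    (2^-1 * expR (- 2))%:E)%E).
  rewrite integral_cst//= lebesgue_measure_itv/= lte_fin ltr1n/=.
  by rewrite -EFinB -EFinM lte_fin !mulr_gt0 ?expR_gt0//; lra.
apply: ge0_le_integral => //.
- exact: measurable_funTS.
- move=> u; rewrite /= in_itv/= => /andP[u1 u2]; rewrite lee_fin.
  apply: ler_pM => //; rewrite ?expR_ge0 ?ler_expR ?lerN2//.
  apply: (@le_trans _ _ (u `^ (- 1))).
    by rewrite powR_inv1 ?lef_pV2 ?posrE//; lra.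
  by apply: ler_powR => //; lra.
Qed.

Lemma c_ns_gt0 (R : realType) n (s : R) : 0 < s < 1 -> 0 < @c_ns R n s.
Proof.
move=> /andP[s0 s1]; rewrite /c_ns; have := ler0n R n => n0.
rewrite mulr_gt0 ?subr_gt0// mulr_gt0// divr_gt0// ?mulr_gt0 ?powR_gt0 ?pi_gt0//.
  by apply: Gamma_gt0; lra.
by apply: Gamma_gt0; lra.
Qed.

(** * Smooth functions and flat functions *)

Section smooth_functions.
Context {R : realType} {V : normedModType R}.

Lemma class_CW {W : normedModType R} k (f : V -> W) :
  class_C k.+1 f -> class_C k f.
Proof.
elim: k f => [|k IH] f [df Df] /=.
  by move=> x; apply: differentiable_continuous.
by split=> // v; apply/IH/Df.
Qed.

Lemma class_C_cst {W : normedModType R} k (c : W) : class_C k (fun _ : V => c).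
Proof.
elim: k c => [|k IH] c /=; first by move=> x; exact: cvg_cst.
split=> [x|v]; first exact: differentiable_cst.
rewrite (_ : 'D_v _ = fun=> 0); first exact: IH.
by apply/funext => x; exact: derive_cst.
Qed.

Lemma class_CD {W : normedModType R} k (f g : V -> W) :
  class_C k f -> class_C k g -> class_C k (fun x => f x + g x).
Proof.
elim: k f g => [|k IH] f g /=; first by move=> cf cg x; apply: cvgD; [exact: cf|exact: cg].
move=> [df Df] [dg Dg]; split=> [x|v]; first exact: differentiableD.
rewrite (_ : 'D_v _ = fun x => 'D_v f x + 'D_v g x); first exact: IH.
by apply/funext => x; apply: deriveD; exact: diff_derivable.
Qed.

Lemma class_CM k (f g : V -> R) :
  class_C k f -> class_C k g -> class_C k (fun x => f x * g x).
Proof.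
elim: k f g => [|k IH] f g; first by move=> cf cg x; apply: cvgM; [exact: cf|exact: cg].
move=> Cf Cg; have [df Df] := Cf; have [dg Dg] := Cg.
split=> [x|v]; first exact: differentiableM.
rewrite (_ : 'D_v _ = fun x => f x * 'D_v g x + g x * 'D_v f x).
  apply: class_CD; apply: IH; try exact: class_CW.
    exact: Dg.
  exact: Df.
by apply/funext => x; apply: deriveM; exact: diff_derivable.
Qed.

Lemma class_CZ {W : normedModType R} k (f : V -> R) (e : W) :
  class_C k f -> class_C k (fun x => f x *: e).
Proof.
elim: k f => [|k IH] f; first by move=> cf x; apply: cvgZr_tmp; exact: cf.
move=> [df Df]; split=> [x|v]; first exact: differentiableZl.
rewrite (_ : 'D_v _ = fun x => 'D_v f x *: e); first exact: (IH _ (Df v)).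
apply/funext => x; rewrite deriveE; last exact: differentiableZl.
by rewrite diffZl// deriveE.
Qed.

Lemma class_CV k (f : V -> R) : (forall x, f x != 0) ->
  class_C k f -> class_C k (fun x => (f x)^-1).
Proof.
move=> f0; elim: k => [|k IH]; first by move=> cf x; apply: cvgV => //; exact: cf.
move=> Cf; have [df Df] := Cf.
split=> [x|v]; first exact: differentiableV.
rewrite (_ : 'D_v _ = fun x => (-1) * ((f x)^-1 * (f x)^-1) * 'D_v f x).
  apply: class_CM; last exact: Df.
  apply: class_CM; first exact: class_C_cst.
  by apply: class_CM; apply: IH; exact: class_CW.
apply/funext => x; rewrite deriveV//; last exact: diff_derivable.
by rewrite mulN1r -invfM -expr2 /GRing.scale.
Qed.

Lemma class_C_sum (I : Type) (r : seq I) k (f : I -> V -> R) :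
  (forall i, class_C k (f i)) -> class_C k (fun x => \sum_(i <- r) f i x).
Proof.
move=> Cf; elim: r => [|i r IH].
  rewrite (_ : (fun x => _) = fun=> 0); first exact: class_C_cst.
  by apply/funext => x; rewrite big_nil.
rewrite (_ : (fun x => _) = fun x => f i x + \sum_(j <- r) f j x).
  exact: class_CD.
by apply/funext => x; rewrite big_cons.
Qed.

End smooth_functions.

Section coordinates.
Context {R : realType} {n : nat}.

Lemma class_C_coord k (i : 'I_n) : class_C k (fun x : 'rV[R]_n => x ord0 i).
Proof.
case: k => [|k] /=; first exact: coord_continuous.
split=> [x|v]; first exact: differentiable_coord.
rewrite (_ : 'D_v _ = fun=> v ord0 i); first exact: class_C_cst.
apply/funext => x; rewrite /derive.
apply/cvg_lim => //; apply: cvg_near_cst.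
near=> h; have h0 : h != 0 by near: h; exact: nbhs_dnbhs_neq.
by rewrite /= !mxE addrK /GRing.scale/= mulrA mulVf// mul1r.
Unshelve. all: by end_near. Qed.

Lemma class_C_dot k (f g : 'rV[R]_n -> 'rV[R]_n) :
  (forall i, class_C k (fun x => f x ord0 i)) ->
  (forall i, class_C k (fun x => g x ord0 i)) ->
  class_C k (fun x => dot (f x) (g x)).
Proof. by move=> Cf Cg; apply: class_C_sum => i; exact: class_CM. Qed.

End coordinates.

Section flat_function.
Context {R : realType}.

Definition flat k (t : R) : R := if 0 < t then t ^- k * expR (- t^-1) else 0.

Lemma flat_ge0 k t : 0 <= flat k t.
Proof.
by rewrite /flat; case: ifP => // t0; rewrite mulr_ge0 ?expR_ge0// invr_ge0 exprn_ge0// ltW.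
Qed.

Lemma flat_le_sqr k (t : R) : `|flat k t| <= k.+2%:R ^+ k.+2 * t ^+ 2.
Proof.
rewrite ger0_norm ?flat_ge0// /flat; case: ifP => t0; last first.
  by rewrite mulr_ge0 ?sqr_ge0// exprn_ge0.
have ti : 0 <= t^-1 by rewrite invr_ge0 ltW.
have -> : t ^- k * expR (- t^-1) = t^-1 ^+ k.+2 / expR t^-1 * t ^+ 2.
  rewrite expRN -[in RHS]addn2 exprD !exprVn mulrAC -mulrA -mulrA.
  by rewrite [X in _ = _ * X]mulrA mulVf ?mul1r// expf_neq0// gt_eqF.
rewrite ler_pM2r ?exprn_gt0// ler_pdivrMr ?expR_gt0//.
exact: expn_le_expR.
Qed.

Lemma is_derive_flat k (t : R) :
  is_derive t (1 : R) (flat k) (- k%:R * flat k.+1 t + flat k.+2 t).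
Proof.
have [t0|t0|->] := ltgtP t 0.
- have -> : - k%:R * flat k.+1 t + flat k.+2 t = 0.
    by rewrite /flat ltNge (ltW t0)/= mulr0 addr0.
  apply: (@near_eq_is_derive _ _ _ (fun=> 0)).
  by near=> y; rewrite /flat ltNge ltW//; near: y; exact: lt_nbhsl.
- have -> : - k%:R * flat k.+1 t + flat k.+2 t =
     t ^- k *: (expR (- t^-1) * t ^- 2) +
     expR (- t^-1) *: (- (t ^+ k) ^- 2 *: ((k%:R * t ^+ k.-1) *: 1)).
    rewrite /flat t0 /GRing.scale/= mulr1; set X := expR _.
    case: k => [|k]; first by rewrite expr0; field; rewrite gt_eqF.
    by rewrite /= !exprS; field; rewrite ?expf_neq0 ?(gt_eqF t0).
  have tn0 : t != 0 by rewrite gt_eqF.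
  apply: (@near_eq_is_derive _ _ _ (fun y : R => y ^- k * expR (- y^-1))).
    by near=> y; rewrite /flat ifT//; near: y; exact: lt_nbhsr.
  apply: is_deriveM.
    apply: is_deriveV; first by rewrite expf_neq0.
    rewrite (_ : (fun x : R => x ^+ k) = id ^+ k); first exact: is_deriveX.
    by apply/funext => x; rewrite exprfctE.
  have H : is_derive t (1 : R) (fun y : R => - y^-1) (t ^- 2).
    have H0 : is_derive t (1 : R) (fun y : R => y^-1) (- t ^- 2 *: 1).
      exact: is_deriveV.
    apply: is_derive_eq (is_deriveN H0) _.
    by rewrite scaleNr opprK /GRing.scale/= mulr1.
  by apply: is_derive1_comp.
- have -> : - k%:R * flat k.+1 0 + flat k.+2 0 = 0.
    by rewrite /flat ltxx mulr0 addr0.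
  have f0 : flat k 0 = 0 by rewrite /flat ltxx.
  apply/is_derive1_caratheodory; exists (fun z => flat k z / z); split.
  + move=> z; rewrite f0 !subr0; have [->|z0] := eqVneq z 0.
      by rewrite f0 mulr0.
    by rewrite divfK.
  + apply/cvgrPdist_lt => e e0; rewrite invr0 mulr0.
    set C := k.+2%:R ^+ k.+2 : R; have C0 : 0 <= C by rewrite exprn_ge0.
    have eC : 0 < e / (C + 1) by rewrite divr_gt0//; lra.
    near=> z; rewrite sub0r normrN.
    have [->|z0] := eqVneq z 0; first by rewrite invr0 mulr0 normr0.
    have nz : 0 < `|z| by rewrite normr_gt0.
    have zlt : `|z| < e / (C + 1) by near: z; exists (e / (C + 1)) => //= y; rewrite /= sub0r normrN.
    rewrite normrM normfV ltr_pdivrMr//; apply: le_lt_trans (flat_le_sqr _ _) _.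
    rewrite -/C -real_normK ?num_real// expr2 mulrA ltr_pM2r//.
    by move: zlt; rewrite ltr_pdivlMr; nra.
  + by rewrite invr0 mulr0.
Unshelve. all: by end_near. Qed.

Lemma class_C_flat {V : normedModType R} m k (q : V -> R) :
  class_C m q -> class_C m (fun x => flat k (q x)).
Proof.
have dflat j t : derivable (flat j) t 1 by have [] := is_derive_flat j t.
have dflat' j t : differentiable (flat j) t by apply/derivable1_diffP.
elim: m k => [|m IH] k.
  move=> cq x; apply: continuous_comp; first exact: cq.
  exact: differentiable_continuous.
move=> Cq; have [dq Dq] := Cq.
split=> [x|v]; first exact: differentiable_comp.
rewrite (_ : 'D_v _ = fun x => (- k%:R * flat k.+1 (q x) + flat k.+2 (q x)) * 'D_v q x).
  apply: class_CM; last exact: Dq.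
  have Cq' := class_CW Cq.
  by apply: class_CD; [apply: class_CM; [exact: class_C_cst|]|]; exact: IH.
apply/funext => x; rewrite deriveE; last exact: differentiable_comp.
rewrite diff_comp//= -[in 'd q x v]deriveE//; have [_ <-] := is_derive_flat k (q x).
set c := 'D_v q x; rewrite -[c in LHS]mulr1 -[c * 1]/(c *: (1 : R)) linearZ/=.
by rewrite -deriveE// mulrC.
Qed.

End flat_function.

(** * A complete scalar flow *)

Section scalar_flow.
Context {R : realType}.
Implicit Types s t w : R.

(* On ]-1, 1[, [clock t = t exp (1 / (1 - t^2))] is an increasing bijection
   onto R with derivative [1 / speed]: it conjugates the flow of the smooth
   field [speed] to translations. *)
Definition clock t : R := t / flat 0 (1 - t ^+ 2).
Definition speed t : R := (1 - t ^+ 2) ^+ 2 * flat 0 (1 - t ^+ 2) / (1 + t ^+ 4).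

Lemma sqr_lt1 t : `|t| < 1 -> t ^+ 2 < 1.
Proof. by move=> t1; rewrite -real_normK ?num_real// exprn_ilt1. Qed.

Lemma speed_gt0 t : `|t| < 1 -> 0 < speed t.
Proof.
move=> /sqr_lt1 t1; rewrite /speed /flat subr_gt0 t1 expr0 invr1 mul1r.
by rewrite divr_gt0 ?ltr_wpDr ?exprn_even_ge0// mulr_gt0 ?expR_gt0 ?exprn_gt0 ?subr_gt0.
Qed.

Lemma speed_out t : 1 <= `|t| -> speed t = 0.
Proof.
move=> t1; rewrite /speed /flat subr_gt0 ltNge.
by rewrite -[t ^+ 2]real_normK ?num_real// exprn_ege1//= mulr0 mul0r.
Qed.

Lemma clockN t : clock (- t) = - clock t.
Proof. by rewrite /clock sqrrN mulNr. Qed.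

Lemma is_derive_clock t : `|t| < 1 -> is_derive t (1 : R) clock (speed t)^-1.
Proof.
move=> t1; have := sqr_lt1 t1; rewrite -subr_gt0 => q0.
have dq : is_derive t (1 : R) (fun x => 1 - x ^+ 2) (- (2 * t)).
  have H : is_derive t (1 : R) (fun x : R => x ^+ 2) ((2%:R * t ^+ 1) *: 1).
    rewrite (_ : (fun x : R => x ^+ 2) = id ^+ 2); first exact: is_deriveX.
    by apply/funext => x; rewrite exprfctE.
  have H1 : is_derive t (1 : R) (fun x : R => 1 - x ^+ 2) (0 - ((2%:R * t ^+ 1) *: 1)).
    exact: is_deriveB.
  by apply: is_derive_eq H1 _; rewrite sub0r /GRing.scale/= mulr1.
have dF : is_derive t (1 : R) (fun x => flat 0 (1 - x ^+ 2))
    ((- 0%:R * flat 1 (1 - t ^+ 2) + flat 2 (1 - t ^+ 2)) * (- (2 * t))).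
  exact: (is_derive1_comp (f := flat 0) (is_derive_flat 0 _) dq).
have F0 : flat 0 (1 - t ^+ 2) != 0.
  by rewrite /flat q0 expr0 invr1 mul1r gt_eqF ?expR_gt0.
set dF0 := (_ * _) in dF.
have dFV : is_derive t (1 : R) (fun x => (flat 0 (1 - x ^+ 2))^-1)
    (- (flat 0 (1 - t ^+ 2)) ^- 2 *: dF0).
  by apply: is_deriveV.
have dC : is_derive t (1 : R) clock
    (t *: (- (flat 0 (1 - t ^+ 2)) ^- 2 *: dF0) + (flat 0 (1 - t ^+ 2))^-1 *: 1).
  by apply: is_deriveM.
apply: is_derive_eq dC _; rewrite /dF0.
rewrite mulr0n oppr0 mul0r add0r /GRing.scale/= mulr1 /speed /flat q0 expr0 invr1 !mul1r.
set q := 1 - t ^+ 2; set e := expR _.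
have e0 : 0 < e by exact: expR_gt0.
have q0' : 0 < q by [].
have t4 : 0 < 1 + t ^+ 4 by rewrite ltr_wpDr ?exprn_even_ge0.
rewrite (_ : 1 + t ^+ 4 = q ^+ 2 + 2 * t ^+ 2); last by rewrite /q; ring.
by field; rewrite ?gt_eqF// -/q; nra.
Qed.

Lemma itv_lt_norm (a b t : R) : -1 < a -> b < 1 -> t \in `[a, b] -> `|t| < 1.
Proof. by move=> a1 b1; rewrite in_itv/= => /andP[? ?]; rewrite ltr_norml; lra. Qed.

Lemma clock_within (a b : R) : -1 < a -> b < 1 -> {within `[a, b], continuous clock}.
Proof.
move=> a1 b1; apply: continuous_in_subspaceT => t /set_mem/= tab.
apply/differentiable_continuous/derivable1_diffP.
by have [] := is_derive_clock (itv_lt_norm a1 b1 tab).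
Qed.

Lemma clock_MVT (a b : R) : -1 < a -> a < b -> b < 1 ->
  exists2 c, a < c < b & clock b - clock a = (speed c)^-1 * (b - a).
Proof.
move=> a1 ab b1.
have [|c] := MVT ab _ (clock_within a1 b1) (df := fun c => (speed c)^-1).
  by move=> c /subset_itv_oo_cc cab; apply/is_derive_clock/(itv_lt_norm a1 b1).
by rewrite in_itv/= => cab ->; exists c.
Qed.

Lemma clock_lt (a b : R) : `|a| < 1 -> `|b| < 1 -> a < b -> clock a < clock b.
Proof.
rewrite !ltr_norml => /andP[a1 a2] /andP[b1 b2] ab.
have [c /andP[ac cb] E] := clock_MVT a1 ab b2.
rewrite -subr_gt0 E mulr_gt0 ?subr_gt0// invr_gt0 speed_gt0// ltr_norml.
by rewrite (lt_trans a1)// (lt_trans cb).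
Qed.

Lemma clock_inj (a b : R) : `|a| < 1 -> `|b| < 1 -> clock a = clock b -> a = b.
Proof.
move=> a1 b1 E; have [ab|ab|//] := ltgtP a b.
  by have := clock_lt a1 b1 ab; rewrite E ltxx.
by have := clock_lt b1 a1 ab; rewrite E ltxx.
Qed.

Lemma clock_surj w : exists t, `|t| < 1 /\ clock t = w.
Proof.
pose r : R := (4 * `|w| + 2)^-1; pose c : R := 1 - r.
have w0 := normr_ge0 w.
have d0 : 0 < 4 * `|w| + 2 by lra.
have r0 : 0 < r by rewrite invr_gt0.
have rE : r * (4 * `|w| + 2) = 1 by rewrite mulVf// gt_eqF.
have r12 : r <= 1 / 2 by nra.
have c1 : c < 1 by rewrite /c; lra.
have c12 : 1 / 2 <= c by rewrite /c; lra.
have q0 : 0 < 1 - c ^+ 2 by rewrite expr2; nra.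
have qw : `|w| <= clock c.
  rewrite /clock /flat q0 expr0 invr1 mul1r expRN invrK.
  have : 2 * `|w| <= expR (1 - c ^+ 2)^-1.
    apply: le_trans (expR_ge1Dx _); rewrite ler_wpDl//.
    rewrite -[leLHS]invrK; have [->|wn0] := eqVneq `|w| 0.
      by rewrite mulr0 !invr0 invr_ge0 ltW.
    rewrite lef_pV2 ?posrE//; last by rewrite invr_gt0; lra.
    have wp : 0 < `|w| by rewrite lt_neqAle eq_sym wn0 w0.
    rewrite -[_^-1]mul1r ler_pdivlMr; last by lra.
    by rewrite /c expr2; nra.
  by nra.
have cN1 : -1 < - c by lra.
have [||t tcc E] := @IVT _ clock (- c) c w _ (clock_within cN1 c1) _; first lra.
  rewrite clockN; move: qw; rewrite ler_norml => /andP[w1 w2].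
  by rewrite ge_min le_max w1 w2 orbT.
by exists t; split => //; apply: itv_lt_norm tcc.
Qed.

Definition unclock w : R := xget 0 [set t | `|t| < 1 /\ clock t = w].

Lemma unclockP w : `|unclock w| < 1 /\ clock (unclock w) = w.
Proof.
rewrite /unclock; case: xgetP => [t _ []//|none].
by have [t tw] := clock_surj w; have := none t tw.
Qed.

Lemma clockK t : `|t| < 1 -> unclock (clock t) = t.
Proof. by move=> t1; have [u1 uE] := unclockP (clock t); exact: clock_inj. Qed.

Lemma is_derive_unclock w : is_derive w (1 : R) unclock (speed (unclock w)).
Proof.
have [u1 uE] := unclockP w; rewrite -[X in is_derive X]uE -[speed _]invrK.
have near1 : \forall t \near unclock w, `|t| < 1.
  have : {for unclock w, continuous (fun t : R => `|t|)} by exact: norm_continuous.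
  by move=> /(_ [set y | y < 1]); apply; exact: lt_nbhsl.
apply: is_derive_inverse.
- by near=> t; apply: clockK; near: t.
- near=> t; apply/differentiable_continuous/derivable1_diffP.
  have t1 : `|t| < 1 by near: t.
  by have [] := is_derive_clock t1.
- exact: is_derive_clock.
- by rewrite invr_eq0 gt_eqF// speed_gt0.
Unshelve. all: by end_near. Qed.

Definition flow1 s t : R := if `|t| < 1 then unclock (clock t + s) else t.

Lemma flow1_in s t : (`|flow1 s t| < 1) = (`|t| < 1).
Proof.
by rewrite /flow1; case: (boolP (`|t| < 1)) => [_|/negbTE->//]; have [->] := unclockP (clock t + s).
Qed.

Lemma flow1_out s t : 1 <= `|t| -> flow1 s t = t.
Proof. by rewrite leNgt /flow1 => /negbTE->. Qed.

Lemma clock_flow1 s t : `|t| < 1 -> clock (flow1 s t) = clock t + s.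
Proof. by rewrite /flow1 => ->; have [_ ->] := unclockP (clock t + s). Qed.

Lemma flow10 t : flow1 0 t = t.
Proof. by rewrite /flow1; case: ifP => // t1; rewrite addr0 clockK. Qed.

Lemma flow1D s s' t : flow1 s (flow1 s' t) = flow1 (s' + s) t.
Proof.
have [t1|t1] := ltP `|t| 1; last by rewrite !flow1_out.
by rewrite {1}/flow1 flow1_in t1 clock_flow1// -addrA [in RHS]/flow1 t1.
Qed.

Lemma is_derive_flow1 s t : is_derive s (1 : R) (flow1 ^~ t) (speed (flow1 s t)).
Proof.
have [t1|t1] := ltP `|t| 1; last first.
  rewrite flow1_out// speed_out// (_ : flow1^~ t = fun=> t).
    exact: is_derive_cst.
  by apply/funext => x; rewrite flow1_out.
rewrite (_ : flow1 ^~ t = unclock \o (fun s => clock t + s)); last first.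
  by apply/funext => x; rewrite /flow1 t1.
have H : is_derive s (1 : R) (fun s => clock t + s) (0 + 1) by exact: is_deriveD.
apply: is_derive_eq (is_derive1_comp (is_derive_unclock _) H) _.
by rewrite add0r mulr1 /flow1 t1.
Qed.

Lemma flow1_lt s t : `|t| < 1 -> s < 0 -> flow1 s t < t.
Proof.
move=> t1 s0; rewrite ltNge; apply/negP => tf.
have := clock_flow1 s t1; have [E|tf'] := eqVneq t (flow1 s t).
  by rewrite -E; lra.
have : clock t < clock (flow1 s t) by apply: clock_lt => //; rewrite ?flow1_in// lt_neqAle tf'.
lra.
Qed.

Lemma flow1_displacement : exists2 L : R, 0 < L & forall s t,
  0 <= s <= L / 4 -> - 4^-1 <= t <= 2^-1 -> flow1 (- s) t <= t - s / L.
Proof.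
exists (2 * expR (4 / 3)) => [|s t]; first by rewrite mulr_gt0 ?expR_gt0.
set L := 2 * _; have L0 : 0 < L by rewrite mulr_gt0 ?expR_gt0.
move=> /andP[s0 sL] /andP[t1 t2].
have ta : `|t| < 1 by rewrite ltr_norml; lra.
have [->|sn0] := eqVneq s 0; first by rewrite oppr0 flow10 mul0r subr0.
have sp : 0 < s by rewrite lt_neqAle eq_sym sn0.
have xt := flow1_lt ta (_ : - s < 0); move: xt; rewrite oppr_lt0 => /(_ sp).
set x := flow1 _ _ => xt.
have sL' : s / L <= 4^-1 by rewrite ler_pdivrMr// mulrC.
have [x12|x12] := leP (- 2^-1) x; last by lra.
have [|||c /andP[xc ct]] := @clock_MVT x t; [lra|by []|lra|].
rewrite clock_flow1// (_ : clock t - _ = s); last by ring.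
suff : (speed c)^-1 <= L.
  move=> cL E; have : s <= L * (t - x) by rewrite E ler_wpM2r//; lra.
  by rewrite mulrC -ler_pdivrMr//; lra.
have c2 : c ^+ 2 <= 4^-1 by rewrite expr2; nra.
have c20 : 0 <= c ^+ 2 by exact: sqr_ge0.
rewrite /speed /flat ifT; last by lra.
set q := 1 - c ^+ 2; rewrite expr0 invr1 mul1r.
have q34 : 3 / 4 <= q by rewrite /q; lra.
have e0 := expR_gt0 (4 / 3 : R).
have : (expR (4 / 3))^-1 <= expR (- q^-1).
  rewrite -expRN ler_expR lerN2 (_ : 4 / 3 = (3 / 4)^-1); last by field.
  by rewrite lef_pV2// posrE; lra.
set e := expR (- q^-1) => ee.
have e'0 : 0 < e by exact: expR_gt0.
have Ee : 1 <= expR (4/3) * e by rewrite mulrC -ler_pdivrMr// div1r.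
have c40 : 0 <= c ^+ 4 by rewrite exprn_even_ge0.
have c4 : c ^+ 4 <= 16^-1.
  by rewrite (_ : c ^+ 4 = c ^+ 2 * c ^+ 2); [nra|ring].
rewrite invf_div ler_pdivrMr; last by rewrite mulr_gt0// exprn_gt0//; lra.
rewrite (_ : L * _ = 2 * q ^+ 2 * (expR (4/3) * e)); last by rewrite /L; ring.
have : 9 / 16 <= q ^+ 2 by rewrite expr2; nra.
nra.
Qed.

Lemma continuous_unclock : continuous unclock.
Proof.
move=> w; apply/differentiable_continuous/derivable1_diffP.
by have [] := is_derive_unclock w.
Qed.

Lemma measurable_flat k : measurable_fun [set: R] (flat k).
Proof.
apply: continuous_measurable_fun => t.
apply/differentiable_continuous/derivable1_diffP.
by have [] := is_derive_flat k t.
Qed.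

Lemma measurable_flow1 d (T : measurableType d) (f g : T -> R) :
  measurable_fun setT f -> measurable_fun setT g ->
  measurable_fun setT (fun x => flow1 (f x) (g x)).
Proof.
move=> mf mg; apply: measurable_fun_ifT => //.
  apply: measurable_fun_ltr => //.
  exact: measurableT_comp.
apply: measurableT_comp; first exact: continuous_measurable_fun continuous_unclock.
apply: measurable_funD => //; apply: measurable_funM => //.
apply: (eq_measurable_fun (fun x => flat 0 (1 - g x ^+ 2) `^ (-1))).
  by move=> x _; rewrite powR_inv1// flat_ge0.
apply: (measurableT_comp (measurable_powR _)).
apply: (measurableT_comp (measurable_flat 0)).
by apply: measurable_funB => //; exact: measurable_funX.
Qed.

End scalar_flow.

(** * Lebesgue measure on row vectors *)

Section measure_on_rows.
Context {R : realType}.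

Definition box n (x : 'rV[R]_n) (r : R) : set 'rV[R]_n :=
  [set y | forall i, `|x ord0 i - y ord0 i| < r].

Lemma measurable_box n (x : 'rV[R]_n) r : measurable (box x r).
Proof.
rewrite (_ : box x r =
    \bigcap_(i in [set: 'I_n]) ((fun y : 'rV[R]_n => y ord0 i) @^-1` ball (x ord0 i) r)).
  apply: fin_bigcap_measurable => // i _.
  rewrite -[X in measurable X]setTI; apply: measurable_coord_rV => //.
  exact: measurable_ball.
by apply/seteqP; split=> [y xy i _|y xy i]; exact: xy.
Qed.

Lemma nbhs_box n (x : 'rV[R]_n) (U : set 'rV[R]_n) : nbhs x U ->
  exists2 r, 0 < r & box x r `<=` U.
Proof.
move=> /nbhs_ballP[r r0 xU]; exists r => // y xy; apply: xU; split => // i j.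
by rewrite !ord1; exact: xy.
Qed.

Lemma open_measurable_rV n (U : set 'rV[R]_n) : open U -> measurable U.
Proof.
move=> oU; pose B (p : 'rV[rat]_n * nat) := box (map_mx ratr p.1 : 'rV[R]_n) (p.2.+1%:R^-1).
rewrite (_ : U = \bigcup_p if `[< B p `<=` U >] then B p else set0).
  apply: countable_bigcupT_measurable => // p.
  by case: ifP => _ //; exact: measurable_box.
apply/seteqP; split=> [y Uy|y [p _]]; last by case: ifP => // /asboolP; apply.
have [r r0 yU] := nbhs_box (open_nbhs_nbhs (conj oU Uy)).
have [k kr] : exists k : nat, 2 / r < k.+1%:R.
  by exists (Num.trunc (2 / r)); exact: truncnS_gt.
have k0 : (0 : R) < k.+1%:R by rewrite ltr0n.
have kr' : 2 * k.+1%:R^-1 < r.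
  by rewrite ltr_pdivrMr// mulrC -ltr_pdivrMr.
have /choice[q qy] : forall i : 'I_n, exists q : rat,
    ratr q \in `](y ord0 i - k.+1%:R^-1), (y ord0 i + k.+1%:R^-1)[.
  have kV : 0 < (k.+1%:R^-1 : R) by rewrite invr_gt0.
  by move=> i; apply: rat_in_itvoo; rewrite ltrBlDr -addrA ltrDl addr_gt0.
have qyi i : `|ratr (q i) - y ord0 i| < k.+1%:R^-1.
  by have := qy i; rewrite in_itv/= ltr_distl.
exists (\row_i q i, k) => //=.
case: asboolP => [_ i|[]]; first by rewrite !mxE.
move=> z zq; apply: yU => i; have := zq i; have := qyi i; rewrite !mxE.
move: kr'; move: (k.+1%:R^-1) => ep epr.
by rewrite !ltr_norml => /andP[? ?] /andP[? ?]; lra.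
Qed.

Lemma closed_measurable_rV n (A : set 'rV[R]_n) : closed A -> measurable A.
Proof.
move=> cA; rewrite -[A]setCK; apply: measurableC; apply: open_measurable_rV.
exact: closed_openC.
Qed.

Lemma lebesgue_rVS n (A : set 'rV[R]_n.+1) :
  lebesgue_rV n.+1 A = (\int[@lebesgue_measure R]_x
    lebesgue_rV n (xsection (@rV_cons R n @^-1` A) x))%E.
Proof. by []. Qed.

Lemma lebesgue_rV_box n (x : 'rV[R]_n) r : 0 <= r ->
  lebesgue_rV n (box x r) = ((2 * r) ^+ n)%:E.
Proof.
move=> r0; elim: n x => [|n IH] x.
  by rewrite /= diracE mem_set// => -[].
rewrite [LHS](_ : _ = (@lebesgue_measure R \x lebesgue_rV n)%E
   (ball (x ord0 ord0) r `*` box (\row_j x ord0 (lift ord0 j)) r)); last first.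
  rewrite /=/lebesgue_step/pushforward; congr (_ _ _); apply/seteqP; split=> -[a y] /=.
    move=> xy; split; first by have := xy ord0; rewrite rV_consE0.
    by move=> j; have := xy (lift ord0 j); rewrite rV_consES !mxE.
  move=> [xa xy] i; have [j ->|->] := unliftP ord0 i.
    by rewrite rV_consES; have := xy j; rewrite mxE.
  by rewrite rV_consE0.
rewrite product_measure1E; [|exact: measurable_ball|exact: measurable_box].
rewrite [X in (X * _)%E](_ : _ = (r *+ 2)%:E); last exact: lebesgue_measure_ball.
rewrite IH -EFinM exprS; congr (_ * _)%:E.
by rewrite mulr_natl.
Qed.

Lemma measurable_shift (a : R) :
  measurable_fun [set: measurableTypeR R] (fun x : measurableTypeR R => x + a : measurableTypeR R).
Proof. exact: measurable_funD. Qed.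

Lemma lebesgue_measure_shift (a : R) (A : set (measurableTypeR R)) : measurable A ->
  lebesgue_measure [set x | A (x + a)] = lebesgue_measure A :> \bar R.
Proof.
move=> mA; rewrite [RHS](@lebesgue_measure_unique R
  (measure_function_pushforward__canonical__measure_function_Measure
    (@lebesgue_measure R) (measurable_shift a)))// => X [[b c] _ <-].
rewrite /= /pushforward (_ : _ @^-1` _ = `](b - a), (c - a)]%classic).
  by rewrite !lebesgue_measure_itv/= !lte_fin ltrD2r -!EFinB; case: ifP => // _; congr (_%:E); lra.
by apply/seteqP; split => x/=; rewrite !in_itv/= => /andP[? ?]; lra.
Qed.

Lemma ge0_integral_shift (a : R) (f : measurableTypeR R -> \bar R) :
  measurable_fun setT f -> (forall x, 0 <= f x)%E ->
  (\int[@lebesgue_measure R]_x f (x + a)%R = \int[@lebesgue_measure R]_x f x)%E.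
Proof.
move=> mf f0.
have := @ge0_integral_pushforward _ _ _ _ R _ (measurable_shift a) (@lebesgue_measure R) setT f measurableT mf (fun x _ => f0 x).
rewrite preimage_setT /= => <-.
apply: eq_measure_integral; first exact: measurable_shift.
by move=> mshift A mA _; exact: lebesgue_measure_shift.
Qed.

Lemma lebesgue_rV_shift n (v : 'rV[R]_n) (A : set 'rV[R]_n) : measurable A ->
  lebesgue_rV n [set x | A (x + v)] = lebesgue_rV n A.
Proof.
elim: n v A => [|n IH] v A mA.
  by congr (_ _); apply/seteqP; split => x /=; rewrite [x + v]thinmx0 [x]thinmx0.
have mA' : measurable (@rV_cons R n @^-1` A).
  by rewrite -[X in measurable X]setTI; exact: measurable_rV_cons.
pose w : 'rV[R]_n := \row_j v ord0 (lift ord0 j).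
pose f x := lebesgue_rV n (xsection (@rV_cons R n @^-1` A) x).
rewrite !lebesgue_rVS -(ge0_integral_shift (v ord0 ord0) (f := f)); last 2 first.
- exact: measurable_fun_xsection.
- by move=> x; exact: measure_ge0.
apply: eq_integral => x _; rewrite /f -[RHS](IH w); last exact: measurable_xsection.
congr (_ _); apply/seteqP; split => y/=; rewrite /xsection/= !inE/=.
all: suff -> : rV_cons (x, y) + v = rV_cons (x + v ord0 ord0, y + w) by [].
all: apply/rowP => i; rewrite !mxE; case: unliftP => [j ->|->] /=; by rewrite ?mxE.
Qed.

Lemma measurable_dot d (T : measurableType d) n (f g : T -> 'rV[R]_n) :
  measurable_fun setT f -> measurable_fun setT g ->
  measurable_fun setT (fun x => dot (f x) (g x)).
Proof.
move=> mf mg; apply: measurable_sum => i; apply: measurable_funM.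
  exact: (measurableT_comp (measurable_coord_rV i) mf).
exact: (measurableT_comp (measurable_coord_rV i) mg).
Qed.

Lemma measurable_subrV d (T : measurableType d) n (f g : T -> 'rV[R]_n) :
  measurable_fun setT f -> measurable_fun setT g ->
  measurable_fun setT (fun x => f x - g x).
Proof.
move=> mf mg; apply: measurable_fun_rV => i.
under eq_fun do rewrite !mxE.
apply: measurable_funB.
  exact: (measurableT_comp (measurable_coord_rV i) mf).
exact: (measurableT_comp (measurable_coord_rV i) mg).
Qed.

End measure_on_rows.

(** * Euclidean geometry *)

Section euclidean_geometry.
Context {R : realType} {n : nat}.
Implicit Types x y z : 'rV[R]_n.

Lemma dotC x y : dot x y = dot y x.
Proof. by apply: eq_bigr => i _; rewrite mulrC. Qed.

Lemma dotDl x y z : dot (x + y) z = dot x z + dot y z.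
Proof. by rewrite /dot -big_split; apply: eq_bigr => i _; rewrite mxE mulrDl. Qed.

Lemma dotZl (a : R) x y : dot (a *: x) y = a * dot x y.
Proof. by rewrite /dot mulr_sumr; apply: eq_bigr => i _; rewrite mxE mulrA. Qed.

Lemma dotDr x y z : dot z (x + y) = dot z x + dot z y.
Proof. by rewrite !(dotC z) dotDl. Qed.

Lemma dotZr (a : R) x y : dot x (a *: y) = a * dot x y.
Proof. by rewrite !(dotC x) dotZl. Qed.

Lemma dotNl x y : dot (- x) y = - dot x y.
Proof. by rewrite -scaleN1r dotZl mulN1r. Qed.

Lemma dotNr x y : dot x (- y) = - dot x y.
Proof. by rewrite dotC dotNl dotC. Qed.

Lemma dotBl x y z : dot (x - y) z = dot x z - dot y z.
Proof. by rewrite dotDl dotNl. Qed.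

Lemma dotBr x y z : dot z (x - y) = dot z x - dot z y.
Proof. by rewrite dotDr dotNr. Qed.

Lemma dot_ge0 x : 0 <= dot x x.
Proof. by apply: sumr_ge0 => i _; rewrite -expr2 sqr_ge0. Qed.

Lemma sqr_enorm x : enorm x ^+ 2 = dot x x.
Proof. by rewrite sqr_sqrtr// dot_ge0. Qed.

Lemma enorm_ge0 x : 0 <= enorm x.
Proof. exact: sqrtr_ge0. Qed.

Lemma dot_cauchy x y : dot x y ^+ 2 <= dot x x * dot y y.
Proof.
have [y0|] := eqVneq (dot y y) 0.
  have yi i : y ord0 i = 0.
    have /eqP := y0; rewrite psumr_eq0 => [/allP/(_ i)|j _]; last by rewrite -expr2 sqr_ge0.
    by rewrite mem_index_enum mulf_eq0 orbb => /(_ isT)/eqP.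
  by rewrite y0 mulr0 /dot big1 ?expr0n// => i _; rewrite yi mulr0.
rewrite neq_lt ltNge dot_ge0/= => y0.
have := dot_ge0 (dot y y *: x - dot x y *: y).
rewrite dotBl !dotBr !dotZl !dotZr (dotC y x) => H.
have : 0 <= dot y y * (dot x x * dot y y - dot x y ^+ 2).
  by apply: le_trans H _; rewrite le_eqVlt; apply/orP; left; apply/eqP; ring.
by rewrite pmulr_rge0// subr_ge0.
Qed.

Lemma dot_le_enorm x y : `|dot x y| <= enorm x * enorm y.
Proof.
rewrite -(@ler_pXn2r _ 2)// ?nnegrE ?mulr_ge0 ?enorm_ge0//.
by rewrite real_normK ?num_real// exprMn !sqr_enorm dot_cauchy.
Qed.

Lemma enormD x y : enorm (x + y) <= enorm x + enorm y.
Proof.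
rewrite -(@ler_pXn2r _ 2)// ?nnegrE ?addr_ge0 ?enorm_ge0//.
rewrite sqr_enorm sqrrD !sqr_enorm dotDl !dotDr (dotC y x).
have := dot_le_enorm x y; rewrite ler_norml => /andP[_ H]; lra.
Qed.

Lemma enormZ (a : R) x : enorm (a *: x) = `|a| * enorm x.
Proof. by rewrite /enorm dotZl dotZr mulrA -expr2 sqrtrM ?sqr_ge0// sqrtr_sqr. Qed.

Lemma enormN x : enorm (- x) = enorm x.
Proof. by rewrite -scaleN1r enormZ normrN1 mul1r. Qed.

Lemma enorm_distC x y : enorm (x - y) = enorm (y - x).
Proof. by rewrite -enormN opprB. Qed.

Lemma enorm_dist_triangle z x y : enorm (x - y) <= enorm (x - z) + enorm (z - y).
Proof. by apply: le_trans (enormD _ _); rewrite addrA subrK. Qed.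

Lemma enorm0 : enorm (0 : 'rV[R]_n) = 0.
Proof. by rewrite -(scale0r 0) enormZ normr0 mul0r. Qed.

Lemma coord_le_enorm x i : `|x ord0 i| <= enorm x.
Proof.
rewrite -sqrtr_sqr ler_wsqrtr// /dot (bigD1 i)//= expr2 lerDl.
by apply: sumr_ge0 => j _; rewrite -expr2 sqr_ge0.
Qed.

Lemma enorm_gt0 x : x != 0 -> 0 < enorm x.
Proof.
move=> x0; rewrite lt_neqAle enorm_ge0 andbT eq_sym; apply: contra x0 => /eqP x0.
apply/eqP/rowP => i; rewrite mxE; apply/eqP; rewrite -normr_le0.
by rewrite -x0 coord_le_enorm.
Qed.

Lemma enorm_lt_coord x (a : R) : 0 < a -> (forall i, `|x ord0 i| < a) ->
  enorm x < n.+1%:R * a.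
Proof.
move=> a0 xa; rewrite -(@ltr_pXn2r _ 2)// ?nnegrE ?mulr_ge0 ?enorm_ge0 ?ltW//.
rewrite sqr_enorm; apply: (@le_lt_trans _ _ (\sum_(i < n) a ^+ 2)).
  apply: ler_sum => i _; rewrite -expr2 -real_normK ?num_real//.
  by apply: lerXn2r; rewrite ?nnegrE ?(ltW a0)// ltW.
rewrite sumr_const card_ord -[_ *+ n]mulr_natl exprMn ltr_pM2r ?exprn_gt0//.
by rewrite -natrX ltr_nat -mulnn leq_pmulr.
Qed.

End euclidean_geometry.

(** * Nonlocal interactions *)

Section interactions.
Context {R : realType} {n : nat}.
Variable s : R.
Implicit Types A B D G F Omega : set 'rV[R]_n.

Definition riesz (p : 'rV[R]_n * 'rV[R]_n) : \bar R :=
  ((enorm (p.1 - p.2) `^ (n%:R + s))^-1)%:E.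

Lemma riesz_ge0 p : (0 <= riesz p)%E.
Proof. by rewrite lee_fin invr_ge0 powR_ge0. Qed.

Lemma rieszC x y : riesz (x, y) = riesz (y, x).
Proof. by rewrite /riesz/= enorm_distC. Qed.

Lemma measurable_riesz : measurable_fun setT riesz.
Proof.
have ms : measurable_fun setT (fun p : 'rV[R]_n * 'rV[R]_n => p.1 - p.2).
  by apply: (@measurable_subrV _ _ _ n fst snd).
have me := measurableT_comp (continuous_measurable_fun (@sqrt_continuous R)) (measurable_dot ms ms).
apply/measurable_EFinP.
have := measurableT_comp (measurable_powR (- (n%:R + s))) me.
by under eq_fun do rewrite /= powRN.
Qed.

Lemma measurable_riesz_section x A : measurable A ->
  measurable_fun A (fun y => riesz (x, y)).
Proof.
move=> mA; have := measurableT_comp measurable_riesz (measurable_pair1 x).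
exact: measurable_funTS.
Qed.

Lemma interaction_ge0 A B : (0 <= interaction s A B)%E.
Proof.
by apply: integral_ge0 => x _; apply: integral_ge0 => y _; exact: (riesz_ge0 (x, y)).
Qed.

Lemma interactionE A B : interaction s A B =
  (\int[lebesgue_rV n]_x \int[lebesgue_rV n]_y (riesz \_ (A `*` B)) (x, y))%E.
Proof.
rewrite /interaction integral_mkcond; apply: eq_integral => x _.
rewrite patchE; case: ifPn => xA.
  rewrite integral_mkcond; apply: eq_integral => y _.
  by rewrite !patchE in_setX/= xA.
by rewrite integral0_eq// => y _; rewrite patchE in_setX/= (negbTE xA).
Qed.

Lemma measurable_riesz_patch A B : measurable A -> measurable B ->
  measurable_fun setT (riesz \_ (A `*` B)).
Proof.
move=> mA mB; apply/(measurable_restrictT _ _).1 => //; first exact: measurableX.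
exact: measurable_funTS measurable_riesz.
Qed.

Lemma riesz_patch_ge0 A B p : (0 <= (riesz \_ (A `*` B)) p)%E.
Proof. by rewrite patchE; case: ifP => // _; exact: riesz_ge0. Qed.

Lemma interactionC A B : measurable A -> measurable B ->
  interaction s A B = interaction s B A.
Proof.
move=> mA mB; rewrite !interactionE fubini_tonelli; last 2 first.
- exact: measurable_riesz_patch.
- exact: riesz_patch_ge0.
apply: eq_integral => x _; apply: eq_integral => y _.
rewrite !patchE !in_setX/= andbC; case: (_ && _); first exact: rieszC.
reflexivity.
Qed.

Lemma measurable_riesz_potential B : measurable B ->
  measurable_fun setT (fun x => \int[lebesgue_rV n]_(y in B) riesz (x, y))%E.
Proof.
move=> mB; rewrite (_ : (fun x => _) = fubini_F (lebesgue_rV n) (riesz \_ (setT `*` B))).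
  apply: measurable_fun_fubini_tonelli_F; first exact: measurable_riesz_patch.
  exact: riesz_patch_ge0.
apply/funext => x; rewrite /fubini_F [LHS]integral_mkcond; apply: eq_integral => y _.
by rewrite !patchE in_setX/= in_setT.
Qed.

Lemma riesz_potential_ge0 B x : (0 <= \int[lebesgue_rV n]_(y in B) riesz (x, y))%E.
Proof. by apply: integral_ge0 => y _; exact: riesz_ge0. Qed.

Lemma interactionUl A A' B : measurable A -> measurable A' -> measurable B ->
  [disjoint A & A'] ->
  interaction s (A `|` A') B = (interaction s A B + interaction s A' B)%E.
Proof.
move=> mA mA' mB AA'; apply: ge0_integral_setU => //.
  exact: measurable_funTS (measurable_riesz_potential mB).
by move=> x _; exact: riesz_potential_ge0.
Qed.

Lemma interactionUr A B B' : measurable A -> measurable B -> measurable B' ->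
  [disjoint B & B'] ->
  interaction s A (B `|` B') = (interaction s A B + interaction s A B')%E.
Proof.
move=> mA mB mB' BB'; rewrite (interactionC mA (measurableU _ _ mB mB')).
by rewrite (interactionUl mB mB' mA BB') (interactionC mB mA) (interactionC mB' mA).
Qed.

Lemma interaction_subl A A' B : measurable A -> measurable A' -> measurable B ->
  A `<=` A' -> (interaction s A B <= interaction s A' B)%E.
Proof.
move=> mA mA' mB AA'; apply: ge0_subset_integral => //.
  exact: measurable_funTS (measurable_riesz_potential mB).
by move=> x _; exact: riesz_potential_ge0.
Qed.

Lemma interaction_lower_bound (c : R) A B : measurable A -> measurable B -> 0 <= c ->
  (forall x y, A x -> B y -> c%:E <= riesz (x, y))%E ->
  (c%:E * lebesgue_rV n B * lebesgue_rV n A <= interaction s A B)%E.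
Proof.
move=> mA mB c0 cAB; rewrite -integral_cst//; apply: ge0_le_integral => //.
- by move=> x _; rewrite mule_ge0// lee_fin.
- exact: measurable_funTS (measurable_riesz_potential mB).
- move=> x Ax; rewrite -integral_cst//; apply: ge0_le_integral => //.
  + exact: measurable_riesz_section.
  + by move=> y By; exact: cAB.
Qed.

(* A Harnack-type comparison: moving the small set [B] to [D] changes its
   interaction with the far set [A] by a bounded factor. *)
Lemma interaction_compare (C b d : R) A B D :
  measurable A -> measurable B -> measurable D -> 0 <= C ->
  lebesgue_rV n B = b%:E -> lebesgue_rV n D = d%:E ->
  (forall x y y', A x -> B y -> D y' -> riesz (x, y') <= C%:E * riesz (x, y))%E ->
  (b%:E * interaction s A D <= C%:E * d%:E * interaction s A B)%E.
Proof.
move=> mA mB mD C0 Bb Dd AC.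
have b0 : (0 <= b%:E)%E by rewrite -Bb measure_ge0.
have d0 : (0 <= d%:E)%E by rewrite -Dd measure_ge0.
have Cd0 : (0 <= C%:E * d%:E)%E by rewrite mule_ge0// lee_fin.
have mp E : measurable E -> measurable_fun A (fun x => \int[lebesgue_rV n]_(y in E) riesz (x, y))%E.
  by move=> mE; exact: measurable_funTS (measurable_riesz_potential mE).
rewrite -(ge0_integralZl _ mA (mp _ mD) (fun x _ => riesz_potential_ge0 D x) b0).
rewrite -(ge0_integralZl _ mA (mp _ mB) (fun x _ => riesz_potential_ge0 B x) Cd0).
apply: ge0_le_integral => //.
- by move=> x _; rewrite mule_ge0// riesz_potential_ge0.
- exact: measurable_funeM (mp _ mD).
- exact: measurable_funeM (mp _ mB).
move=> x Ax; rewrite -[leRHS]ge0_integralZl//; last 2 first.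
- exact: measurable_riesz_section.
- by move=> y _; exact: (riesz_ge0 (x, y)).
rewrite muleC -Bb -[leLHS]integral_cst//; apply: ge0_le_integral => //.
- by move=> y _; exact: riesz_potential_ge0.
- exact: measurable_funeM (measurable_riesz_section _ mB).
move=> y By /=; rewrite -muleA [X in (_ <= _ * X)%E]muleC muleA -Dd -[leRHS]integral_cst//.
apply: ge0_le_integral => //.
- by move=> y' _; exact: (riesz_ge0 (x, y')).
- exact: measurable_riesz_section.
- by move=> y' Dy'; exact: AC.
Qed.

Local Opaque interaction.

Definition perimeter_integral G Omega : \bar R :=
  (interaction s (~` G `&` Omega) (G `&` Omega)
   + interaction s (G `&` Omega) (~` G `&` ~` Omega)
   + interaction s (G `&` ~` Omega) (~` G `&` Omega))%E.

Lemma PerE G Omega : Per s G Omega = ((@c_ns R n s)%:E * perimeter_integral G Omega)%E.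
Proof. by []. Qed.

Lemma perimeter_integral_ge0 G Omega : (0 <= perimeter_integral G Omega)%E.
Proof. by apply: adde_ge0; [apply: adde_ge0|]; exact: interaction_ge0. Qed.

Lemma perimeter_integralC G Omega : measurable G -> measurable Omega ->
  perimeter_integral (~` G) Omega = perimeter_integral G Omega.
Proof.
move=> mG mO; rewrite /perimeter_integral setCK.
have mGC := measurableC mG; have mOC := measurableC mO.
rewrite [interaction s (G `&` Omega) (~` G `&` Omega)]interactionC; try exact: measurableI.
rewrite [interaction s (~` G `&` Omega) (G `&` ~` Omega)]interactionC; try exact: measurableI.
rewrite [interaction s (~` G `&` ~` Omega) (G `&` Omega)]interactionC; try exact: measurableI.
move: (interaction _ _ _) (interaction _ _ _) (interaction _ _ _) => a b c.
by rewrite -!addeA [X in (_ + X)%E]addeC.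
Qed.

Lemma perimeter_integral_grow G F Omega : measurable G -> measurable F ->
  measurable Omega -> G `<=` F -> F `\` G `<=` ~` Omega ->
  (perimeter_integral F Omega + interaction s (G `&` Omega) (F `\` G) =
   perimeter_integral G Omega + interaction s (F `\` G) (~` G `&` Omega))%E.
Proof.
move=> mG mF mO GF DO.
have mGC := measurableC mG; have mOC := measurableC mO; have mFC := measurableC mF.
have mD := measurableD mF mG.
have FO : F `&` Omega = G `&` Omega.
  apply/seteqP; split=> x [? Ox]; last by split => //; exact: GF.
  by split => //; apply: contrapT => Gx; exact: (DO x).
have FCO : ~` F `&` Omega = ~` G `&` Omega.
  apply/seteqP; split=> x [Fx Ox]; first by split => // /GF.
  by split => // Fx'; exact: (DO x).
rewrite /perimeter_integral FO FCO.
rewrite [in RHS](_ : ~` G `&` ~` Omega = (~` F `&` ~` Omega) `|` (F `\` G)); last first.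
  apply/seteqP; split=> x.
    by move=> [Gx Ox]; have [Fx|Fx] := pselect (F x); [right|left].
  by move=> [[Fx Ox]|[Fx Gx]]; split => //; [move=> /GF|exact: DO].
rewrite [in RHS](@interactionUr (G `&` Omega) (~` F `&` ~` Omega) (F `\` G)); last first.
- by apply/disj_setPS => x [[Fx _] [Fx' _]].
- exact: mD.
- exact: measurableI.
- exact: measurableI.
rewrite [in LHS](_ : F `&` ~` Omega = (G `&` ~` Omega) `|` (F `\` G)); last first.
  apply/seteqP; split=> x.
    by move=> [Fx Ox]; have [Gx|Gx] := pselect (G x); [left|right].
  by move=> [[Gx Ox]|[Fx Gx]]; split => //; [exact: GF|exact: DO].
rewrite [in LHS](@interactionUl (G `&` ~` Omega) (F `\` G) (~` G `&` Omega)); last first.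
- by apply/disj_setPS => x [[Gx _] [_ Gx']].
- exact: measurableI.
- exact: mD.
- exact: measurableI.
move: (interaction _ _ _) (interaction _ _ _) (interaction _ _ _)
  (interaction _ _ _) (interaction _ _ _) => a b c d e.
rewrite -!addeA; congr (_ + (_ + _))%E.
by rewrite [RHS]addeCA; congr (_ + _)%E; exact: addeC.
Qed.

End interactions.

Section sticking_decreases.
Context {R : realType} {n : nat}.
Implicit Types A B D G F Omega : set 'rV[R]_n.

Lemma riesz_lower (s r : R) (x y : 'rV[R]_n) : 0 < s -> x != y -> enorm (x - y) <= r ->
  ((r `^ (n%:R + s))^-1%:E <= riesz s (x, y))%E.
Proof.
move=> s0 xy xyr; have n0 := ler0n R n.
have e0 : 0 < enorm (x - y) by rewrite enorm_gt0// subr_eq0.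
rewrite /riesz lee_fin lef_pV2 ?posrE ?powR_gt0//; last exact: lt_le_trans xyr.
have r0 : 0 <= r := le_trans (enorm_ge0 _) xyr.
by apply: ge0_ler_powR; rewrite ?nnegrE ?enorm_ge0//; lra.
Qed.

Lemma riesz_harnack (s rho : R) (x0 x y y' : 'rV[R]_n) : 0 < s ->
  rho <= enorm (x - x0) -> enorm (y - x0) < rho / 2 -> enorm (y' - x0) < rho / 2 ->
  (riesz s (x, y') <= (3 `^ (n%:R + s))%:E * riesz s (x, y))%E.
Proof.
move=> s0 xr yr yr'; have n0 := ler0n R n.
have H1 := enorm_dist_triangle x0 x y; rewrite (enorm_distC x0 y) in H1.
have H2 := enorm_dist_triangle y' x x0.
have H3 := enorm_dist_triangle y x x0.
have e0' : 0 < enorm (x - y') by lra.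
have e0 : 0 < enorm (x - y) by lra.
rewrite /riesz -EFinM lee_fin /=.
have -> : 3 `^ (n%:R + s) * (enorm (x - y) `^ (n%:R + s))^-1 =
    ((enorm (x - y) / 3) `^ (n%:R + s))^-1.
  have E : enorm (x - y) `^ (n%:R + s) = (enorm (x - y) / 3) `^ (n%:R + s) * 3 `^ (n%:R + s).
    by rewrite -powRM ?divr_ge0 ?enorm_ge0// divfK.
  by rewrite E invfM mulrCA mulfV ?mulr1// gt_eqF// powR_gt0.
rewrite lef_pV2 ?posrE ?powR_gt0 ?divr_gt0//.
by apply: ge0_ler_powR; rewrite ?nnegrE ?divr_ge0 ?enorm_ge0//; lra.
Qed.

Lemma lebesgue_rV_enorm_fin (x0 : 'rV[R]_n) (r : R) D : measurable D ->
  (forall y, D y -> enorm (y - x0) < r) -> exists2 d : R, 0 <= d & lebesgue_rV n D = d%:E.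
Proof.
move=> mD Dr; have [->|/set0P[y Dy]] := eqVneq D set0.
  by exists 0 => //; rewrite measure0.
have r0 : 0 <= r by apply/ltW/(le_lt_trans (enorm_ge0 _) (Dr y Dy)).
have Dfin : (lebesgue_rV n D <= ((2 * r) ^+ n)%:E)%E.
  rewrite -(lebesgue_rV_box x0 r0); apply: le_measure; rewrite ?inE//.
    exact: measurable_box.
  move=> z /Dr zr i; apply: le_lt_trans zr; rewrite enorm_distC.
  by have := coord_le_enorm (x0 - z) i; rewrite !mxE.
exists (fine (lebesgue_rV n D)); first by rewrite fine_ge0.
by rewrite fineK// ge0_fin_numE// (le_lt_trans Dfin)// ltry.
Qed.

(* Attaching to [G], outside [Omega], a set [D] within distance [r] of the
   sticking point creates at most [M |D|] of interaction with the far set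
   [Omega \ G], but removes the interaction of [D] with a ball of radius
   [kappa r] in [Omega], which is at least [c r^(-s) |D|]. *)
Lemma sticking_decreases (s : R) G Omega (x0 p : 'rV[R]_n) (rho b kappa r0 : R) :
  0 < s -> measurable G -> measurable Omega ->
  (perimeter_integral s G Omega < +oo)%E ->
  0 < rho -> 0 < b -> 0 < kappa -> 0 < r0 ->
  (forall y, Omega y -> enorm (y - x0) < rho -> G y) ->
  (forall y, box p b y -> [/\ G y, ~ Omega y & enorm (y - x0) < rho / 2]) ->
  (forall r, 0 < r < r0 -> exists c, forall y, box c (kappa * r) y ->
     Omega y /\ enorm (y - x0) < 2 * r) ->
  exists2 r, 0 < r & forall F, measurable F -> G `<=` F ->
    (forall y, F y -> ~ G y -> ~ Omega y /\ enorm (y - x0) < r) ->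
    (perimeter_integral s F Omega + lebesgue_rV n (F `\` G)
       <= perimeter_integral s G Omega)%E.
Proof.
move=> s0 mG mO Gfin rho0 b0 k0 r00 Grho pb cork; have n0 := ler0n R n.
pose C : R := 3 `^ (n%:R + s); have C0 : 0 < C by exact: powR_gt0.
pose q := fine (perimeter_integral s G Omega).
have qE : perimeter_integral s G Omega = q%:E.
  by rewrite fineK// ge0_fin_numE// perimeter_integral_ge0.
have q0 : 0 <= q by rewrite -lee_fin -qE perimeter_integral_ge0.
pose bn : R := (2 * b) ^+ n; have bn0 : 0 < bn by rewrite exprn_gt0// mulr_gt0.
pose M : R := C * q / bn; have M0 : 0 <= M by rewrite divr_ge0 ?mulr_ge0// ltW.
pose Z : R := (M + 1) * C / (2 * kappa) ^+ n.
have Z0 : 0 < Z by rewrite divr_gt0 ?exprn_gt0 ?mulr_gt0//; lra.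
pose r1 : R := Z `^ (- s^-1); have r10 : 0 < r1 by exact: powR_gt0.
pose r := Num.min r1 (Num.min (r0 / 2) (rho / 2)).
have rr1 : r <= r1 by rewrite /r ge_min lexx.
have rr0 : r <= r0 / 2 by rewrite /r !ge_min lexx orbT.
have rrho : r <= rho / 2 by rewrite /r !ge_min lexx !orbT.
have rp : 0 < r by rewrite /r !lt_min r10 !divr_gt0.
have rZ : Z <= (r `^ s)^-1.
  rewrite -[leLHS]invrK lef_pV2 ?posrE ?invr_gt0 ?powR_gt0//.
  apply: (@le_trans _ _ (r1 `^ s)).
    by apply: ge0_ler_powR; rewrite ?nnegrE ?(ltW s0)// ltW.
  by rewrite /r1 -powRrM mulNr mulVf ?gt_eqF// powR_inv1// ltW.
exists r => // F mF GF FD.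
set D := F `\` G; have mD : measurable D by exact: measurableD.
have mGO : measurable (G `&` Omega) by exact: measurableI.
have mGCO : measurable (~` G `&` Omega) by apply: measurableI => //; exact: measurableC.
have Dr y : D y -> enorm (y - x0) < r by move=> [Fy Gy]; have [] := FD y Fy Gy.
have DO : D `<=` ~` Omega by move=> y [Fy Gy]; have [] := FD y Fy Gy.
have [d d0 dE] := lebesgue_rV_enorm_fin mD Dr.
have upper : (interaction s D (~` G `&` Omega) <= (M * d)%:E)%E.
  rewrite interactionC//.
  have mb := measurable_box p b.
  have := @interaction_compare R n s C bn d (~` G `&` Omega) (box p b) D mGCO mb mD (ltW C0).
  rewrite lebesgue_rV_box ?(ltW b0)// => /(_ erefl dE).
  have H x y y' : (~` G `&` Omega) x -> box p b y -> D y' ->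
      (riesz s (x, y') <= C%:E * riesz s (x, y))%E.
    move=> [Gx Ox] /pb[_ _ yr] /Dr y'r; apply: (@riesz_harnack _ rho x0) => //.
      by rewrite leNgt; apply/negP => /(Grho _ Ox).
    exact: lt_le_trans rrho.
  move=> /(_ H) {}H.
  have Hb : (interaction s (~` G `&` Omega) (box p b) <= q%:E)%E.
    rewrite -qE interactionC// /perimeter_integral.
    apply: (@le_trans _ _ (interaction s (G `&` ~` Omega) (~` G `&` Omega))).
      apply: interaction_subl => //.
        by apply: measurableI => //; exact: measurableC.
      by move=> y /pb[].
    rewrite addeC leeDl//.
    by apply: adde_ge0; exact: interaction_ge0.
  have : (bn%:E * interaction s (~` G `&` Omega) D <= bn%:E * (M * d)%:E)%E.
    apply: (le_trans H).
    rewrite -!EFinM (_ : bn * (M * d) = C * d * q); last first.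
      by rewrite /M; field; rewrite gt_eqF.
    by rewrite [leRHS]EFinM lee_pmul// ?lee_fin ?mulr_ge0 ?(ltW C0)// interaction_ge0.
  by rewrite lee_pmul2l// lte_fin.
have lower : (((M + 1) * d)%:E <= interaction s (G `&` Omega) D)%E.
  have [|c cB] := cork r; first by rewrite rp/=; lra.
  have mc := measurable_box c (kappa * r).
  have kr0 : 0 <= kappa * r by rewrite mulr_ge0 ?ltW.
  have cG : box c (kappa * r) `<=` G `&` Omega.
    by move=> y /cB[Oy yr]; split => //; apply: Grho => //; lra.
  apply: le_trans (interaction_subl s mc mGO mD cG).
  pose K : R := ((3 * r) `^ (n%:R + s))^-1.
  have K0 : 0 <= K by rewrite invr_ge0 powR_ge0.
  have HK x y : box c (kappa * r) x -> D y -> (K%:E <= riesz s (x, y))%E.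
    move=> /cB[Ox xr] Dy; apply: riesz_lower => //.
      by apply/eqP => xy; apply: (DO y) => //; rewrite -xy.
    apply: le_trans (enorm_dist_triangle x0 _ _) _.
    by rewrite (enorm_distC x0); have := Dr _ Dy; lra.
  apply: le_trans (interaction_lower_bound mc mD K0 HK).
  rewrite dE lebesgue_rV_box// -!EFinM lee_fin mulrAC ler_wpM2r//.
  have -> : K * (2 * (kappa * r)) ^+ n = (2 * kappa) ^+ n / C * (r `^ s)^-1.
    have alg (u v w z : R) : u != 0 -> v != 0 -> w != 0 ->
        (w * (u * v))^-1 * (z * u) = z / w / v.
      by move=> u0 v0 w0; field; rewrite u0 v0 w0.
    rewrite /K powRM ?(ltW rp)// [r `^ _]powRD; last by rewrite (gt_eqF rp) implybT.
    by rewrite powR_mulrn ?(ltW rp)// [2 * _]mulrA exprMn alg// gt_eqF ?exprn_gt0 ?powR_gt0.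
  apply: (@le_trans _ _ ((2 * kappa) ^+ n / C * Z)).
    have alg (u w z : R) : u != 0 -> w != 0 -> u / w * (z * w / u) = z.
      by move=> u0 w0; field; rewrite u0 w0.
    by rewrite alg// gt_eqF ?exprn_gt0 ?mulr_gt0.
  by rewrite ler_wpM2l// divr_ge0 ?exprn_ge0 ?mulr_ge0 ?ltW.
have grow := perimeter_integral_grow s mG mF mO GF DO.
have Dfin : (M * d)%:E \is a fin_num by [].
rewrite -(leeD2rE _ _ Dfin) dE -addeA -EFinD (_ : d + M * d = (M + 1) * d); last by ring.
apply: (@le_trans _ _ (perimeter_integral s F Omega + interaction s (G `&` Omega) D)%E).
  exact: leeD2l.
rewrite grow; exact: (leeD2l _ upper).
Qed.

End sticking_decreases.

(** * The bump flow *)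

Section bump_flow.
Context {R : realType} {n : nat}.
Variables (y0 e : 'rV[R]_n) (delta : R).
Hypotheses (e1 : dot e e = 1) (delta0 : 0 < delta).
Implicit Types (y z : 'rV[R]_n) (t : R).

Definition axial y : R := delta^-1 * dot (y - y0) e.
Definition radial y : R := dot (y - y0) (y - y0) - dot (y - y0) e ^+ 2.
Definition cutoff y : R := flat 0 (1 - (delta ^+ 2)^-1 * radial y).
Definition bump_field y : 'rV[R]_n := (delta * (cutoff y * speed (axial y))) *: e.
Definition bump_flow t y : 'rV[R]_n :=
  y + (delta * (flow1 (t * cutoff y) (axial y) - axial y)) *: e.

Lemma axial_shift (c : R) y : axial (y + c *: e) = axial y + delta^-1 * c.
Proof. by rewrite /axial addrAC [dot (_ + c *: e) _]dotDl dotZl e1 mulr1 mulrDr. Qed.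

Lemma radial_shift (c : R) y : radial (y + c *: e) = radial y.
Proof.
rewrite /radial addrAC; move: (y - y0) => v.
by rewrite !dotDl !dotDr !dotZl !dotZr e1 (dotC e); ring.
Qed.

Lemma radialE y : radial y = dot ((y - dot y e *: e) - (y0 - dot y0 e *: e))
  ((y - dot y e *: e) - (y0 - dot y0 e *: e)).
Proof.
rewrite (_ : (y - dot y e *: e) - (y0 - dot y0 e *: e) = (y - y0) - dot (y - y0) e *: e); last first.
  by rewrite dotBl; apply/rowP => i; rewrite !mxE; ring.
by rewrite /radial; move: (y - y0) => v; rewrite dotBl !dotBr !dotZl !dotZr e1 (dotC e); ring.
Qed.

Lemma dot_axial y : dot y e = dot y0 e + delta * axial y.
Proof. by rewrite /axial mulrA mulfV ?gt_eqF// mul1r dotBl addrC subrK. Qed.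

Lemma sqr_dist_bump y : dot (y - y0) (y - y0) = radial y + delta ^+ 2 * axial y ^+ 2.
Proof. by rewrite /radial /axial; field; rewrite gt_eqF. Qed.

Lemma orth_bump_flow t y : bump_flow t y - dot (bump_flow t y) e *: e = y - dot y e *: e.
Proof.
rewrite /bump_flow dotDl dotZl e1 mulr1 scalerDl opprD addrACA subrr addr0 //.
Qed.

Lemma axial_bump_flow t y : axial (bump_flow t y) = flow1 (t * cutoff y) (axial y).
Proof.
by rewrite /bump_flow axial_shift mulrA mulVf ?gt_eqF// mul1r addrC subrK.
Qed.

Lemma radial_bump_flow t y : radial (bump_flow t y) = radial y.
Proof. by rewrite /bump_flow radial_shift. Qed.

Lemma cutoff_bump_flow t y : cutoff (bump_flow t y) = cutoff y.
Proof. by rewrite /cutoff radial_bump_flow. Qed.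

Lemma bump_flow0 y : bump_flow 0 y = y.
Proof. by rewrite /bump_flow mul0r flow10 subrr mulr0 scale0r addr0. Qed.

Lemma bump_flowD t t' y : bump_flow t (bump_flow t' y) = bump_flow (t' + t) y.
Proof.
rewrite [LHS]/bump_flow cutoff_bump_flow axial_bump_flow flow1D -mulrDl.
by rewrite /bump_flow -addrA -scalerDl -mulrDr [X in delta * X]addrC addrA subrK.
Qed.

Lemma bump_flowK t y : bump_flow t (bump_flow (- t) y) = y.
Proof. by rewrite bump_flowD addNr bump_flow0. Qed.

Lemma bump_flowNK t y : bump_flow (- t) (bump_flow t y) = y.
Proof. by rewrite bump_flowD addrN bump_flow0. Qed.

Lemma bump_flow_image t (G : set 'rV[R]_n) : bump_flow t @` G = bump_flow (- t) @^-1` G.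
Proof.
apply/seteqP; split=> [_ [y Gy <-]|y Gy] /=; first by rewrite bump_flowNK.
by exists (bump_flow (- t) y) => //; rewrite bump_flowK.
Qed.

Lemma is_flow_bump : is_flow bump_field bump_flow.
Proof.
split=> [y|t y]; first exact: bump_flow0.
have H1 : is_derive t (1 : R) (fun u : R => u * cutoff y) (cutoff y).
  have H : is_derive t (1 : R) (fun u : R => u * cutoff y) (t *: 0 + cutoff y *: 1).
    exact: is_deriveM.
  by apply: is_derive_eq H _; rewrite scaler0 add0r /GRing.scale/= mulr1.
have H2 : is_derive t (1 : R) (fun u : R => flow1 (u * cutoff y) (axial y))
    (speed (flow1 (t * cutoff y) (axial y)) * cutoff y).
  exact: (is_derive1_comp (f := flow1 ^~ (axial y)) (is_derive_flow1 _ _) H1).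
have H3 : is_derive t (1 : R) (fun u : R => delta * (flow1 (u * cutoff y) (axial y) - axial y))
    (delta *: (speed (flow1 (t * cutoff y) (axial y)) * cutoff y - 0)).
  by apply: is_deriveZ; apply: is_deriveB.
rewrite /bump_field cutoff_bump_flow axial_bump_flow.
have [d3 D3] := H3.
have d3' : differentiable (fun u : R => delta * (flow1 (u * cutoff y) (axial y) - axial y)) t.
  exact/derivable1_diffP.
have dZ := differentiableZl e d3'.
have H4 : is_derive t (1 : R) (fun u : R => (delta * (flow1 (u * cutoff y) (axial y) - axial y)) *: e)
    ((delta * (cutoff y * speed (flow1 (t * cutoff y) (axial y)))) *: e).
  apply: DeriveDef; first exact/derivable1_diffP.
  rewrite deriveE// diffZl// -deriveE// D3 subr0; congr (_ *: _).
  by rewrite /GRing.scale/= [X in _ * X]mulrC.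
have H5 : is_derive t (1 : R) (bump_flow ^~ y)
    (0 + (delta * (cutoff y * speed (flow1 (t * cutoff y) (axial y)))) *: e).
  exact: is_deriveD.
by apply: is_derive_eq H5 _; rewrite add0r.
Qed.

Lemma class_C_sub_coord k i : class_C k (fun y : 'rV[R]_n => (y - y0) ord0 i).
Proof.
rewrite (_ : (fun y => _) = fun y : 'rV[R]_n => y ord0 i + - y0 ord0 i).
  by apply: class_CD; [exact: class_C_coord|exact: class_C_cst].
by apply/funext => y; rewrite !mxE.
Qed.

Lemma class_C_axial k : class_C k axial.
Proof.
apply: class_CM; first exact: class_C_cst.
by apply: class_C_dot => i; [exact: class_C_sub_coord|exact: class_C_cst].
Qed.

Lemma class_C_radial k : class_C k radial.
Proof.
rewrite (_ : radial = fun y => dot (y - y0) (y - y0) + (-1) * (dot (y - y0) e * dot (y - y0) e)).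
  have Ce : class_C k (fun y => dot (y - y0) e).
    by apply: class_C_dot => i; [exact: class_C_sub_coord|exact: class_C_cst].
  apply: class_CD; first by apply: class_C_dot => i; exact: class_C_sub_coord.
  by apply: class_CM; [exact: class_C_cst|exact: class_CM].
by apply/funext => y; rewrite mulN1r -expr2.
Qed.

Lemma class_C_flat0_sub k (q : 'rV[R]_n -> R) : class_C k q ->
  class_C k (fun y => flat 0 (1 - q y)).
Proof.
move=> Cq; apply: class_C_flat.
rewrite (_ : (fun y => _) = fun y => 1 + (-1) * q y).
  apply: class_CD; first exact: class_C_cst.
  by apply: class_CM => //; exact: class_C_cst.
by apply/funext => y; rewrite mulN1r.
Qed.

Lemma class_C_bump_field k : class_C k bump_field.
Proof.
apply: class_CZ; apply: class_CM; first exact: class_C_cst.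
have Ca := class_C_axial k.
apply: class_CM.
  apply: class_C_flat0_sub; apply: class_CM; [exact: class_C_cst|exact: class_C_radial].
have Ca2 := class_CM Ca Ca.
rewrite (_ : (fun y => speed (axial y)) = fun y =>
   ((1 + (-1) * (axial y * axial y)) * (1 + (-1) * (axial y * axial y))) *
   flat 0 (1 - axial y * axial y) * (1 + (axial y * axial y) * (axial y * axial y))^-1).
  have C1 : class_C k (fun y => 1 + (-1) * (axial y * axial y)).
    apply: class_CD; first exact: class_C_cst.
    by apply: class_CM => //; exact: class_C_cst.
  apply: class_CM.
    by apply: class_CM; [exact: class_CM|exact: class_C_flat0_sub].
  apply: class_CV.
    by move=> y; rewrite gt_eqF// ltr_wpDr// -expr2 sqr_ge0.
  by apply: class_CD; [exact: class_C_cst|exact: class_CM].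
by apply/funext => y; rewrite /speed mulN1r -!expr2 -exprM.
Qed.

Lemma bump_inside y : `|axial y| < 1 -> radial y < delta ^+ 2 -> enorm (y - y0) < 2 * delta.
Proof.
move=> a1 rd; rewrite -(@ltr_pXn2r _ 2)// ?nnegrE ?enorm_ge0 ?mulr_ge0 ?ltW//.
rewrite sqr_enorm sqr_dist_bump; have a2 := sqr_lt1 a1.
have d2 : 0 < delta ^+ 2 by rewrite exprn_gt0.
have ad : delta ^+ 2 * axial y ^+ 2 < delta ^+ 2 by rewrite gtr_pMr.
rewrite (_ : (2 * delta) ^+ 2 = 4 * delta ^+ 2); [lra|ring].
Qed.

Lemma cutoff_out y : delta ^+ 2 <= radial y -> cutoff y = 0.
Proof.
move=> dr; rewrite /cutoff /flat ifF//; apply/negbTE; rewrite -leNgt subr_le0.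
by rewrite ler_pdivlMl ?mulr1// exprn_gt0.
Qed.

Lemma bump_flow_out t y : 2 * delta <= enorm (y - y0) -> bump_flow t y = y.
Proof.
move=> yd; have [a1|a1] := ltP `|axial y| 1; last first.
  by rewrite /bump_flow flow1_out// subrr mulr0 scale0r addr0.
have [r1|r1] := ltP (radial y) (delta ^+ 2).
  by have := bump_inside a1 r1; rewrite ltNge yd.
by rewrite /bump_flow cutoff_out// mulr0 flow10 subrr mulr0 scale0r addr0.
Qed.

Lemma bump_field_out y : 2 * delta <= enorm (y - y0) -> bump_field y = 0.
Proof.
move=> yd; have [a1|a1] := ltP `|axial y| 1; last first.
  by rewrite /bump_field speed_out// !mulr0 scale0r.
have [r1|r1] := ltP (radial y) (delta ^+ 2).
  by have := bump_inside a1 r1; rewrite ltNge yd.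
by rewrite /bump_field cutoff_out// mul0r mulr0 scale0r.
Qed.

Lemma smooth_bump_field : smooth_compactly_supported bump_field.
Proof.
split; first exact: class_C_bump_field.
pose K : set 'rV[R]_n := [set y | forall i,
  `[y0 ord0 i - 2 * delta, y0 ord0 i + 2 * delta]%classic (y ord0 i)].
have cK : compact K.
  apply: (@rV_compact R n
    (fun i => `[y0 ord0 i - 2 * delta, y0 ord0 i + 2 * delta]%classic)) => i.
  exact: segment_compact.
apply: (subclosed_compact _ cK); first exact: closed_closure.
rewrite [K](closure_id _).1; last by apply: compact_closed => //; exact: norm_hausdorff.
apply: closure_subset => y /= Xy i; rewrite /= in_itv/=.
have : enorm (y - y0) < 2 * delta.
  by rewrite ltNge; apply: contra Xy => /bump_field_out ->.
have := coord_le_enorm (y - y0) i; rewrite !mxE => yi yd.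
by have := le_lt_trans yi yd; rewrite ltr_norml => /andP[? ?]; lra.
Qed.

Lemma measurable_bump_flow t : measurable_fun setT (bump_flow t).
Proof.
have mid : measurable_fun setT (fun y : 'rV[R]_n => y - y0).
  by apply: (@measurable_subrV _ _ _ n id (cst y0)).
have me := measurable_dot mid (measurable_cst e).
have max : measurable_fun setT axial by exact: measurable_funM.
have mr : measurable_fun setT radial.
  by apply: measurable_funB; [exact: measurable_dot|exact: measurable_funX].
have mc : measurable_fun setT cutoff.
  apply: (measurableT_comp (measurable_flat 0)).
  by apply: measurable_funB => //; exact: measurable_funM.
apply: measurable_fun_rV => i; rewrite /bump_flow.
under eq_fun do rewrite !mxE.
apply: measurable_funD; first exact: measurable_coord_rV.
apply: measurable_funM => //; apply: measurable_funM => //; apply: measurable_funB => //.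
by apply: measurable_flow1 => //; exact: measurable_funM.
Qed.

Lemma measurable_bump_flow_image t (G : set 'rV[R]_n) :
  measurable G -> measurable (bump_flow t @` G).
Proof.
move=> mG; rewrite bump_flow_image -[X in measurable X]setTI.
exact: measurable_bump_flow.
Qed.

End bump_flow.

(** * Growth of a subgraph along the bump flow *)

Lemma open_lt_fun (T : topologicalType) (R : realType) (f : T -> R) (c : R) :
  continuous f -> open [set x | f x < c].
Proof. by move=> cf; apply: (open_comp (D := [set y | y < c])) => // x _; exact: cf. Qed.

Lemma open_gt_fun (T : topologicalType) (R : realType) (f : T -> R) (c : R) :
  continuous f -> open [set x | c < f x].
Proof. by move=> cf; apply: (open_comp (D := [set y | c < y])) => // x _; exact: cf. Qed.

Lemma closed_le_fun (T : topologicalType) (R : realType) (f : T -> R) (c : R) :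
  continuous f -> closed [set x | f x <= c].
Proof.
by move=> cf; apply: (closed_comp (D := [set y | y <= c])) => // x _; exact: cf.
Qed.

Lemma continuous_dot (R : realType) n (e : 'rV[R]_n) : continuous (fun y => dot y e).
Proof.
by apply: (@class_C_dot _ _ 0) => i; [exact: class_C_coord|exact: class_C_cst].
Qed.

Lemma continuous_orth (R : realType) n (e : 'rV[R]_n) :
  continuous (fun y : 'rV[R]_n => y - dot y e *: e).
Proof.
have C0 : class_C 0 (fun y : 'rV[R]_n => y + (-1 * dot y e) *: e).
  apply: class_CD; first by move=> y; exact: cvg_id.
  apply: class_CZ; apply: class_CM; first exact: class_C_cst.
  exact: continuous_dot.
rewrite (_ : (fun y => _) = fun y : 'rV[R]_n => y + (-1 * dot y e) *: e) //.
by apply/funext => y; rewrite mulN1r scaleNr.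
Qed.

Lemma continuous_graph_height (R : realType) n (e : 'rV[R]_n) (g : 'rV[R]_n -> R) :
  continuous g -> continuous (fun y => dot y e - g (y - dot y e *: e)).
Proof.
move=> cg.
rewrite (_ : (fun y => _) = fun y => dot y e + (-1) * g (y - dot y e *: e)).
  apply: (@class_CD _ _ _ 0); first exact: continuous_dot.
  apply: (@class_CM _ _ 0 (fun=> -1)); first exact: class_C_cst.
  by move=> z; apply: continuous_comp; [exact: continuous_orth|exact: cg].
by apply/funext => y; rewrite mulN1r.
Qed.

Lemma lebesgue_rV_open_gt0 (R : realType) n (U : set 'rV[R]_n) : open U -> U !=set0 ->
  (0 < lebesgue_rV n U)%E.
Proof.
move=> oU [x Ux]; have [r r0 xU] := nbhs_box (open_nbhs_nbhs (conj oU Ux)).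
apply: (@lt_le_trans _ _ (lebesgue_rV n (box x r))).
  by rewrite lebesgue_rV_box ?(ltW r0)// lte_fin exprn_gt0// mulr_gt0.
by apply: le_measure; rewrite ?inE//; [exact: measurable_box|exact: open_measurable_rV].
Qed.

Lemma flat0_le (R : realType) (t u : R) : t <= u -> flat 0 t <= flat 0 u.
Proof.
move=> tu; rewrite /flat !expr0 !invr1 !mul1r.
have [t0|t0] := ltP 0 t; last by case: ifP => // _; exact: expR_ge0.
by rewrite (lt_le_trans t0 tu) ler_expR lerN2 lef_pV2// posrE// (lt_le_trans t0).
Qed.

Lemma flat0_le1 (R : realType) (t : R) : flat 0 t <= 1.
Proof.
rewrite /flat; case: ifP => // t0; rewrite expr0 invr1 mul1r -[leRHS]expR0 ler_expR.
by rewrite oppr_le0 invr_ge0 ltW.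
Qed.

Section graph_growth.
Context {R : realType} {n : nat}.
Variables (y0 e : 'rV[R]_n) (delta : R).
Hypotheses (e1 : dot e e = 1) (delta0 : 0 < delta).
Variables (G : set 'rV[R]_n) (g : 'rV[R]_n -> R).
Hypotheses (mG : measurable G) (cg : continuous g) (gy0 : g (y0 - dot y0 e *: e) = dot y0 e).
Hypothesis Glo : forall z, enorm (z - y0) < 2 * delta ->
  dot z e < g (z - dot z e *: e) -> G z.
Hypothesis Ghi : forall z, enorm (z - y0) < 2 * delta ->
  G z -> dot z e <= g (z - dot z e *: e).

Let ax := axial y0 e delta.
Let rad := radial y0 e.
Let flow := bump_flow y0 e delta.

Let height z := dot z e - g (z - dot z e *: e).

Lemma bump_flow_grows t : 0 <= t -> G `<=` flow t @` G.
Proof.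
move=> t0 z Gz; rewrite /flow (bump_flow_image _ e1 delta0) /=.
set w := bump_flow _ _ _ _ _.
have [a1|a1] := ltP `|ax z| 1; last first.
  by rewrite /w /bump_flow flow1_out// subrr mulr0 scale0r addr0.
have [r1|r1] := ltP (rad z) (delta ^+ 2); last first.
  by rewrite /w /bump_flow (cutoff_out delta0)// mulr0 flow10 subrr mulr0 scale0r addr0.
have [s0|s0] := eqVneq (t * cutoff y0 e delta z) 0.
  by rewrite /w /bump_flow mulNr s0 oppr0 flow10 subrr mulr0 scale0r addr0.
have aw : axial y0 e delta w = flow1 (- t * cutoff y0 e delta z) (ax z).
  exact: axial_bump_flow.
have wz : dot w e < dot z e.
  rewrite (dot_axial y0 e delta0 w) (dot_axial y0 e delta0 z) ltrD2l ltr_pM2l// aw flow1_lt// mulNr oppr_lt0.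
  by rewrite lt_neqAle eq_sym s0 mulr_ge0// flat_ge0.
apply: Glo; first apply: (bump_inside (e := e)) => //.
- by rewrite aw flow1_in.
- by rewrite radial_bump_flow.
rewrite /w (orth_bump_flow _ _ e1) -/w; apply: lt_le_trans wz _.
by apply: Ghi => //; exact: (bump_inside (e := e)).
Qed.

Let continuous_rad : continuous rad.
Proof. exact: (@class_C_radial _ _ y0 e 0). Qed.

Let continuous_height : continuous height.
Proof. exact: continuous_graph_height. Qed.

Let slab (eta h : R) : set 'rV[R]_n := [set z | rad z < eta /\ 0 < height z <= h].

Let measurable_slab eta h : measurable (slab eta h).
Proof.
rewrite (_ : slab eta h = [set z | rad z < eta] `&` [set z | 0 < height z] `&` [set z | height z <= h]).
  apply: measurableI; last by apply: closed_measurable_rV; exact: closed_le_fun.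
  by apply: measurableI; apply: open_measurable_rV; [exact: open_lt_fun|exact: open_gt_fun].
by apply/seteqP; split=> z /=; [move=> [? /andP[? ?]]|move=> [[? ?] ?]; split => //; apply/andP].
Qed.

(* The slab of height [j h] is covered by [j] translates of the slab of
   height [h], so that translation invariance alone bounds the latter below. *)
Let slab_tiling eta h j : 0 <= h ->
  (lebesgue_rV n (slab eta (j%:R * h)%R) <= j%:R%:E * lebesgue_rV n (slab eta h))%E.
Proof.
move=> h0; elim: j => [|j IH].
  rewrite mul0e (_ : slab _ _ = set0) ?measure0//.
  by apply/seteqP; split => // z [_ /andP[z0 z1]]; move: z1; rewrite mul0r leNgt z0.
pose T := [set z | slab eta h (z + - (j%:R * h) *: e)].
have mT : measurable T.
  rewrite -[T]/((fun z => z + - (j%:R * h) *: e) @^-1` slab eta h) -[X in measurable X]setTI.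
  suff : measurable_fun setT (fun z : 'rV[R]_n => z + - (j%:R * h) *: e) by apply.
  apply: measurable_fun_rV => i; under eq_fun do rewrite mxE.
  by apply: measurable_funD => //; exact: measurable_coord_rV.
have TE : (lebesgue_rV n T <= lebesgue_rV n (slab eta h))%E.
  by rewrite /T lebesgue_rV_shift.
apply: (@le_trans _ _ (lebesgue_rV n (slab eta (j%:R * h)%R `|` T))).
  apply: le_measure; rewrite ?inE//; first exact: measurableU.
  move=> z [rz /andP[h1 h2]].
  have [hj|hj] := leP (height z) (j%:R * h); [left|right]; first by split => //; rewrite h1.
  rewrite /T /= /slab /= /rad radial_shift//; split => //.
  rewrite /height dotDl dotZl e1 mulr1 scalerDl opprD addrACA subrr addr0.
  move: h2 hj; rewrite /height -natr1 mulrDl mul1r => h2 hj.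
  by apply/andP; split; lra.
apply: le_trans (measureU2 _ _ _) _ => //.
by rewrite -natr1 EFinD ge0_muleDl ?lee_fin// mul1e; exact: leeD.
Qed.

Lemma bump_flow_growth_rate : exists w c K : R, [/\ 0 < w, 0 < c &
  forall k : nat, K <= k.+1%:R ->
    ((w / k.+1%:R)%:E <= lebesgue_rV n ((flow (c / k.+1%:R) @` G) `\` G))%E].
Proof.
have [L L0 disp] := @flow1_displacement R.
have [eta [eta0 etad getaP]] : exists eta, [/\ 0 < eta, eta <= delta / 2 &
    forall z, rad z < eta ^+ 2 ->
      `|g (z - dot z e *: e) - dot y0 e| < delta / 4].
  have d4 : 0 < delta / 4 by rewrite divr_gt0.
  have : nbhs (y0 - dot y0 e *: e) [set v | `|g v - dot y0 e| < delta / 4].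
    have cgx : {for y0 - dot y0 e *: e, continuous g} by exact: cg.
    have /cvgrPdist_lt/(_ _ d4) := cgx.
    by apply: filterS => v; rewrite gy0 /= distrC.
  move=> /nbhs_box[r r0 rg]; exists (Num.min r (delta / 2)); split.
  - by rewrite lt_min r0 divr_gt0.
  - by rewrite ge_min lexx orbT.
  move=> z rz; apply: rg => i; rewrite distrC.
  have zr : enorm ((z - dot z e *: e) - (y0 - dot y0 e *: e)) < r.
    rewrite -(@ltr_pXn2r _ 2)// ?nnegrE ?enorm_ge0 ?(ltW r0)//.
    rewrite sqr_enorm -(radialE _ e1); apply: (lt_le_trans rz).
    apply: lerXn2r; rewrite ?nnegrE ?(ltW r0)//; last by rewrite ge_min lexx.
    by rewrite le_min (ltW r0) divr_ge0// ltW.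
  apply: le_lt_trans zr; apply: le_trans (coord_le_enorm _ i).
  by rewrite !mxE.
pose W : set 'rV[R]_n := [set z | rad z < eta ^+ 2] `&`
  ([set z | dot y0 e + delta / 4 < dot z e] `&` [set z | dot z e < dot y0 e + delta / 2]).
have oW : open W.
  apply: openI; first exact: open_lt_fun.
  by apply: openI; [apply: open_gt_fun|apply: open_lt_fun]; exact: continuous_dot.
have W0 : W !=set0.
  exists (y0 + (3 / 8 * delta) *: e); split.
    rewrite /= /rad radial_shift// /radial subrr /dot.
    rewrite big1 => [|i _]; last by rewrite mxE mul0r.
    rewrite big1 => [|i _]; last by rewrite mxE mul0r.
    by rewrite expr0n subr0 exprn_gt0.
  by rewrite /= dotDl dotZl e1 mulr1; split; lra.
have W_gt0 := lebesgue_rV_open_gt0 oW W0.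
have mW := open_measurable_rV oW.
pose a0 : R := flat 0 (3 / 4).
have a00 : 0 < a0.
  by rewrite /a0 /flat ifT ?expr0 ?invr1 ?mul1r ?expR_gt0//; lra.
have d2 : 0 < delta ^+ 2 by rewrite exprn_gt0.
have e2d : eta ^+ 2 <= delta ^+ 2 / 4.
  rewrite (_ : delta ^+ 2 / 4 = (delta / 2) ^+ 2); last by field.
  by apply: lerXn2r; rewrite ?nnegrE ?divr_ge0// ltW.
have gB z : rad z < eta ^+ 2 -> dot y0 e - delta / 4 < g (z - dot z e *: e) < dot y0 e + delta / 4.
  by move=> /getaP; rewrite ltr_distl.
have Wslab h k : 3 / 4 * delta <= k%:R * h -> W `<=` slab (eta ^+ 2) (k%:R * h).
  move=> kh z [rz [/= z1 z2]]; split => //; have /andP[g1 g2] := gB _ rz.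
  by rewrite /height; apply/andP; split; lra.
have growth h t : 0 <= h -> h <= delta / 4 -> 0 <= t -> t <= L / 4 ->
    2 * h <= delta * (t * a0 / L) -> slab (eta ^+ 2) h `<=` (flow t @` G) `\` G.
  move=> h0 hd t0 tL ht z [rz /andP[z0 zh]].
  have /andP[g1 g2] := gB _ rz; move: z0 zh; rewrite /height => z0 zh.
  have za := dot_axial y0 e delta0 z; rewrite -/(ax z) in za.
  have ax1 : - 4^-1 <= ax z by rewrite -(ler_pM2l delta0); lra.
  have ax2 : ax z <= 2^-1 by rewrite -(ler_pM2l delta0); lra.
  have zin : enorm (z - y0) < 2 * delta.
    by apply: (bump_inside (e := e)) => //; [rewrite ltr_norml -/(ax z); lra|rewrite -/(rad z); lra].
  split; last by move=> /(Ghi zin); rewrite leNgt => /negP; apply; lra.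
  rewrite /flow (bump_flow_image _ e1 delta0) /=.
  set w := bump_flow _ _ _ _ _.
  have aw : axial y0 e delta w = flow1 (- (t * cutoff y0 e delta z)) (ax z).
    by rewrite -mulNr; exact: axial_bump_flow.
  have ca : a0 <= cutoff y0 e delta z.
    apply: flat0_le; rewrite lerBrDl -lerBrDr ler_pdivrMl// -/(rad z).
    by apply: (le_trans (ltW rz)); lra.
  have c1 : cutoff y0 e delta z <= 1 by exact: flat0_le1.
  have s0 : 0 <= t * cutoff y0 e delta z by rewrite mulr_ge0// flat_ge0.
  have sL : t * cutoff y0 e delta z <= L / 4 by apply: le_trans tL; rewrite ler_piMr.
  have dz := disp (t * cutoff y0 e delta z) (ax z).
  rewrite s0 sL ax1 ax2 in dz; have {}dz := dz isT isT.
  rewrite -aw in dz.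
  have dz2 : t * a0 / L <= t * cutoff y0 e delta z / L.
    by rewrite ler_pM2r ?invr_gt0// ler_wpM2l.
  have dz3 : delta * axial y0 e delta w <= delta * ax z - delta * (t * a0 / L).
    by rewrite -mulrBr ler_pM2l//; lra.
  apply: Glo.
    apply: (bump_inside (e := e)) => //; last by rewrite radial_bump_flow// -/(rad z); lra.
    by rewrite aw flow1_in ltr_norml; lra.
  rewrite /w (orth_bump_flow _ _ e1) -/w (dot_axial y0 e delta0 w).
  have [h00|h00] := eqVneq h 0; first by lra.
  have hp : 0 < h by rewrite lt_neqAle eq_sym h00.
  by lra.
have [wf wfE] : exists w, [/\ 0 < w & (w%:E <= lebesgue_rV n W)%E].
  move: W_gt0; case: (lebesgue_rV n W) => [r|_|//]; last by exists 1; rewrite leey.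
  by rewrite lte_fin => r0; exists r.
case: wfE => wf0 wfW.
pose c : R := 3 / 2 * L / a0.
exists wf, c, (Num.max 3 (6 / a0)); split => // [|k].
  by rewrite divr_gt0// mulr_gt0//; lra.
rewrite ge_max => /andP[k3 k6].
have k0 : (0 : R) < k.+1%:R by rewrite ltr0n.
pose h : R := 3 / 4 * delta / k.+1%:R.
have hk : k.+1%:R * h = 3 / 4 * delta by rewrite /h mulrC divfK// gt_eqF.
have h0 : 0 < h by rewrite divr_gt0// mulr_gt0//; lra.
have hd : h <= delta / 4 by rewrite /h ler_pdivrMr//; nra.
have ck : c / k.+1%:R <= L / 4.
  rewrite ler_pdivrMr// /c ler_pdivrMr//.
  move: k6; rewrite ler_pdivrMr// => k6; nra.
have cd : 2 * h <= delta * (c / k.+1%:R * a0 / L).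
  rewrite le_eqVlt; apply/orP; left; apply/eqP; rewrite /h /c; field.
  by rewrite !gt_eqF.
have cp : 0 <= c / k.+1%:R.
  by rewrite divr_ge0 ?(ltW k0)// /c divr_ge0 ?(ltW a00)// mulr_ge0 ?(ltW L0)//; lra.
have S := growth h _ (ltW h0) hd cp ck cd.
have mflow : measurable (flow (c / k.+1%:R) @` G `\` G).
  by apply: measurableD => //; exact: measurable_bump_flow_image.
apply: (@le_trans _ _ (lebesgue_rV n (slab (eta ^+ 2) h))); last first.
  by apply: le_measure; rewrite ?inE.
have T : (lebesgue_rV n W <= k.+1%:R%:E * lebesgue_rV n (slab (eta ^+ 2) h))%E.
  apply: le_trans (slab_tiling _ _ (ltW h0)).
  by apply: le_measure; rewrite ?inE//; apply: Wslab; rewrite hk.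
have {}T := le_trans wfW T.
by rewrite EFinM muleC lee_pdivrMl.
Qed.

End graph_growth.

(** * Geometry of the boundaries *)

Section boundary_geometry.
Context {R : realType} {n : nat}.
Implicit Types (x y z e : 'rV[R]_n) (E Omega : set 'rV[R]_n).

Lemma continuous_enorm_sub x : continuous (fun y : 'rV[R]_n => enorm (y - x)).
Proof.
have cd : continuous (fun y : 'rV[R]_n => dot (y - x) (y - x)).
  by apply: (@class_C_dot _ _ 0) => i; exact: class_C_sub_coord.
by move=> y; apply: (continuous_comp (cd y)); exact: sqrt_continuous.
Qed.

Lemma nbhs_enorm x (r : R) : 0 < r -> nbhs x [set y | enorm (y - x) < r].
Proof.
move=> r0; apply: open_nbhs_nbhs; split; last by rewrite /= subrr enorm0.
exact/open_lt_fun/continuous_enorm_sub.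
Qed.

Lemma nbhs_enormP x (U : set 'rV[R]_n) : nbhs x U ->
  exists2 r, 0 < r & forall y, enorm (y - x) < r -> U y.
Proof.
move=> /nbhs_box[r r0 rU]; exists r => // y yr; apply: rU => i.
apply: le_lt_trans yr; rewrite enorm_distC.
by have := coord_le_enorm (x - y) i; rewrite !mxE.
Qed.

Lemma open_boundaryE E x : open E -> boundary E x <-> closure E x /\ ~ E x.
Proof. by move=> /interior_id oE; rewrite /boundary oE. Qed.

Lemma graph_boundary E x e (g : 'rV[R]_n -> R) (r : R) : open E -> boundary E x ->
  continuous g -> 0 < r ->
  (forall y, eball x r y -> (E y <-> dot y e < g (y - dot y e *: e))) ->
  g (x - dot x e *: e) = dot x e.
Proof.
move=> oE /(open_boundaryE _ oE)[clE nE] cg r0 H.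
have xx : eball x r x by rewrite /eball /= subrr enorm0.
apply/eqP; rewrite eq_le; apply/andP; split.
  by rewrite leNgt; apply/negP => /(H _ xx).
rewrite leNgt; apply/negP => gx.
have ch := continuous_graph_height (e := e) cg.
have : nbhs x [set y | 0 < dot y e - g (y - dot y e *: e)].
  apply: open_nbhs_nbhs; split; first exact: open_gt_fun.
  by rewrite /= subr_gt0.
move=> h; have [y [Ey [yr /= yh]]] := clE _ (filterI (nbhs_enorm x r0) h).
by have := (H y yr).1 Ey; lra.
Qed.

Lemma segment_boundary E (a b : 'rV[R]_n) : open E -> E a -> ~ E b ->
  exists2 l : R, 0 <= l <= 1 & boundary E (a + l *: (b - a)).
Proof.
move=> oE Ea Eb; apply: contrapT => nb.
pose f (l : R) := a + l *: (b - a).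
have cf : continuous f.
  move=> l; apply: cvgD; first exact: cvg_cst.
  exact: cvgZr_tmp.
pose B := `[0, 1]%classic `&` f @^-1` E.
have /(_ B) : connected `[(0 : R), 1]%classic by exact: segment_connected.
have B0 : B !=set0.
  by exists 0; split; rewrite /f /= ?in_itv/= ?lexx ?ler01// scale0r addr0.
move=> /(_ B0) H; apply: Eb.
have : B = `[0, 1]%classic.
  apply: H.
    exists (f @^-1` E) => //; apply: open_comp => // l _; exact: cf.
  exists (f @^-1` closure E); first by apply: closed_comp => [l _|]; [exact: cf|exact: closed_closure].
  apply/seteqP; split => l [l01 El]; split => //; first exact: subset_closure.
  apply: contrapT => nE; apply: nb; exists l; first by move: l01; rewrite /= in_itv.
  exact/open_boundaryE.
move=> BE; have : B 1 by rewrite BE /= in_itv/= ler01 lexx.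
by move=> [_]; rewrite /f /= scale1r addrC subrK.
Qed.

Lemma mx_norm_le_enorm x : `|x| <= enorm x.
Proof.
rewrite /Num.norm/= mx_normrE; apply: bigmax_le; first exact: enorm_ge0.
by move=> [i j] _; rewrite !ord1 coord_le_enorm.
Qed.

Lemma differentiable_lipschitz_at (g : 'rV[R]_n -> R) x : differentiable g x ->
  exists L r : R, [/\ 0 <= L, 0 < r &
    forall h, enorm h < r -> `|g (x + h) - g x| <= L * enorm h].
Proof.
move=> dg.
pose S := \sum_(i < n) `|'d g x (delta_mx ord0 i)|.
have S0 : 0 <= S by apply: sumr_ge0.
have dS h : `|'d g x h| <= S * enorm h.
  rewrite [h in 'd g x h]row_sum_delta linear_sum /= mulr_suml.
  apply: le_trans (ler_norm_sum _ _ _) _; apply: ler_sum => i _.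
  by rewrite linearZ /= normrM mulrC ler_wpM2l// coord_le_enorm.
have /eqaddoP/(_ 1 ltr01) ho := diff_locally dg.
have [r r0 ro] := nbhs_enormP ho.
exists (S + 1), r; split => // [|h hr]; first lra.
have := ro h; rewrite subr0 => /(_ hr); rewrite /= mul1r => oh.
have -> : g (x + h) - g x = 'd g x h + (g (h + x) - (g x + 'd g x h)).
  by rewrite [h + x]addrC; ring.
apply: le_trans (ler_normD _ _) _; rewrite mulrDl mul1r lerD//.
exact: le_trans (mx_norm_le_enorm h).
Qed.

Lemma enorm_orth e x : dot e e = 1 -> enorm (x - dot x e *: e) <= enorm x.
Proof.
move=> e1; rewrite -(@ler_pXn2r _ 2)// ?nnegrE ?enorm_ge0// !sqr_enorm.
rewrite dotBl !dotBr !dotZl !dotZr e1 (dotC e); have := sqr_ge0 (dot x e); nra.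
Qed.

Lemma orthD e x y : (x + y) - dot (x + y) e *: e = (x - dot x e *: e) + (y - dot y e *: e).
Proof. by rewrite dotDl scalerDl opprD addrACA. Qed.

Lemma orthZ e (a : R) : dot e e = 1 -> a *: e - dot (a *: e) e *: e = 0.
Proof. by move=> e1; rewrite dotZl e1 mulr1 subrr. Qed.

Lemma enorm_unit e : dot e e = 1 -> enorm e = 1.
Proof. by move=> e1; rewrite /enorm e1 sqrtr1. Qed.

Lemma dot_le_unit e x : dot e e = 1 -> `|dot x e| <= enorm x.
Proof. by move=> e1; rewrite -[leRHS]mulr1 -(enorm_unit e1) dot_le_enorm. Qed.

Lemma interior_corkscrew Omega x0 e (g : 'rV[R]_n -> R) (r : R) :
  open Omega -> boundary Omega x0 -> dot e e = 1 -> class_C 1 g -> 0 < r ->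
  (forall y, eball x0 r y -> (Omega y <-> dot y e < g (y - dot y e *: e))) ->
  exists kappa r0 : R, [/\ 0 < kappa, 0 < r0 &
    forall t, 0 < t < r0 -> exists c, forall y, box c (kappa * t) y ->
      Omega y /\ enorm (y - x0) < 2 * t].
Proof.
move=> oO bO e1 Cg r0 H; have cg : continuous g by exact: (class_CW Cg).
have gx := graph_boundary oO bO cg r0 H.
have [L [rho [L0 rho0 lip]]] := differentiable_lipschitz_at (Cg.1 (x0 - dot x0 e *: e)).
pose th : R := (2 + L)^-1.
have th0 : 0 < th by rewrite invr_gt0; lra.
have thE : th * (2 + L) = 1 by rewrite mulVf// gt_eqF//; lra.
have th1 : th < 1 by nra.
exists (th / n.+1%:R), (Num.min rho (r / 2)); split.
- by rewrite divr_gt0// ltr0n.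
- by rewrite lt_min rho0 divr_gt0.
move=> t; rewrite lt_min => /andP[t0 /andP[trho tr]].
exists (x0 - t *: e) => y yc; set w := y - (x0 - t *: e).
have wt : enorm w < th * t.
  have -> : th * t = n.+1%:R * (th / n.+1%:R * t).
    by rewrite mulrA mulrCA mulfV ?mulr1// gt_eqF// ltr0n.
  apply: enorm_lt_coord; first by rewrite mulr_gt0// divr_gt0// ltr0n.
  by move=> i; have := yc i; rewrite /w -normrN !mxE; congr (`|_| < _); ring.
have yE : y = x0 + (w + (- t) *: e).
  by rewrite /w scaleNr; apply/rowP => i; rewrite !mxE; ring.
have yx : enorm (y - x0) < 2 * t.
  rewrite yE addrC addKr; apply: le_lt_trans (enormD _ _) _.
  rewrite enormZ (enorm_unit e1) mulr1 normrN gtr0_norm//; nra.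
split => //; apply/H; first by rewrite /eball /=; lra.
have orthE : y - dot y e *: e = (x0 - dot x0 e *: e) + (w - dot w e *: e).
  by rewrite yE !orthD orthZ// addr0.
rewrite orthE; have wo := enorm_orth w e1.
have wrho : enorm (w - dot w e *: e) < rho by apply: (le_lt_trans wo); nra.
have := lip _ wrho; rewrite gx ler_norml => /andP[lo _].
have we := dot_le_unit w e1; move: we; rewrite ler_norml => /andP[_ we].
have dy : dot y e = dot x0 e + (dot w e - t).
  by rewrite yE dotDl (dotDl w) dotZl e1 mulr1.
rewrite dy.
have Lw : L * enorm (w - dot w e *: e) <= L * enorm w by rewrite ler_wpM2l.
have Lw2 : L * enorm w <= L * (th * t) by rewrite ler_wpM2l// ltW.
have ttE : th * t * (2 + L) = t by rewrite mulrAC thE mul1r.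
have tt0 : 0 < th * t by rewrite mulr_gt0.
lra.
Qed.

Lemma graph_boundary_epigraph E x e (g : 'rV[R]_n -> R) (r : R) :
  dot e e = 1 -> continuous g -> 0 < r ->
  (forall y, eball x r y -> (E y <-> dot y e < g (y - dot y e *: e))) ->
  g (x - dot x e *: e) = dot x e ->
  forall d, 0 < d -> exists q, (~` E)° q /\ enorm (q - x) < d.
Proof.
move=> e1 cg r0 H gx d d0; pose t := Num.min (r / 2) (d / 2).
have t0 : 0 < t by rewrite lt_min !divr_gt0.
have tr : t <= r / 2 by rewrite ge_min lexx.
have td : t <= d / 2 by rewrite ge_min lexx orbT.
have te : enorm (t *: e) = t by rewrite enormZ (enorm_unit e1) mulr1 gtr0_norm.
have xt : enorm (x + t *: e - x) = t by rewrite addrC addKr.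
exists (x + t *: e); split; last by rewrite xt; lra.
have ch := continuous_graph_height (e := e) cg.
have oU : open ([set y | 0 < dot y e - g (y - dot y e *: e)] `&` [set y | enorm (y - x) < r]).
  by apply: openI; [exact: open_gt_fun|apply: open_lt_fun; exact: continuous_enorm_sub].
apply: filterS (open_nbhs_nbhs (conj oU _)) => [y [/= gy yr] /(H y yr)|].
  by move: gy; lra.
split; last by rewrite /= xt; lra.
by rewrite /= orthD (orthZ _ e1) addr0 gx dotDl dotZl e1 mulr1; lra.
Qed.

(* Near [x0] the complement of [Omega] contains the connected open epigraph of
   [g], which meets both [E] and the interior of its complement. *)
Lemma boundary_points_outside E Omega x0 e (g : 'rV[R]_n -> R) (rO : R) :
  open E -> dot e e = 1 -> continuous g -> 0 < rO ->
  (forall y, eball x0 rO y -> (Omega y <-> dot y e < g (y - dot y e *: e))) ->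
  g (x0 - dot x0 e *: e) = dot x0 e ->
  (forall r, 0 < r -> exists p, [/\ E p, ~ Omega p & enorm (p - x0) < r]) ->
  (forall r, 0 < r -> exists q, [/\ (~` E)° q, ~ Omega q & enorm (q - x0) < r]) ->
  forall r, 0 < r ->
  [/\ exists p b, 0 < b /\
        forall y, box p b y -> [/\ E y, ~ Omega y & enorm (y - x0) < r],
      exists q b, 0 < b /\
        forall y, box q b y -> [/\ ~ E y, ~ Omega y & enorm (y - x0) < r] &
      exists y rho, [/\ boundary E y, enorm (y - x0) < r, 0 < rho &
        forall z, enorm (z - y) < rho -> ~ Omega z]].
Proof.
move=> oE e1 cg rO0 H gx Ep Eq r'0 r'00.
pose r := Num.min r'0 rO; have r0 : 0 < r by rewrite lt_min r'00.
have rr' : r <= r'0 by rewrite ge_min lexx.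
have rrO : r <= rO by rewrite ge_min lexx orbT.
have cgo : continuous (fun y : 'rV[R]_n => g (y - dot y e *: e)).
  by move=> z; apply: continuous_comp; [exact: continuous_orth|exact: cg].
have ch := continuous_graph_height (e := e) cg.
pose O : set 'rV[R]_n := [set y | 0 < dot y e - g (y - dot y e *: e)] `&`
  [set y | enorm (y - x0) < r].
have oO : open O.
  by apply: openI; [exact: open_gt_fun|apply: open_lt_fun; exact: continuous_enorm_sub].
have OP z : g (z - dot z e *: e) < dot z e -> enorm (z - x0) < r -> O z.
  by move=> gz zr; split => //=; rewrite subr_gt0.
have OO z : O z -> ~ Omega z.
  move=> [/= gz zr] /H; rewrite /eball/= => /(_ (lt_le_trans zr rrO)).
  by move: gz; lra.
have r8 : 0 < r / 8 by rewrite divr_gt0.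
have [rc rc0 gc] : exists2 rc, 0 < rc & forall z, enorm (z - x0) < rc ->
    `|g (z - dot z e *: e) - dot x0 e| < r / 8.
  have cgx : {for x0, continuous (fun y : 'rV[R]_n => g (y - dot y e *: e))} by exact: cgo.
  have /cvgrPdist_lt/(_ _ r8) := cgx; rewrite gx => /nbhs_enormP[rc rc0 rcH].
  by exists rc => // z /rcH /=; rewrite distrC.
pose a := Num.min rc (r / 8); have a0 : 0 < a by rewrite lt_min rc0.
have arc : a <= rc by rewrite ge_min lexx.
have ar : a <= r / 8 by rewrite ge_min lexx orbT.
have a20 : 0 < a / 2 by rewrite divr_gt0.
have up A p : open A -> A p -> ~ Omega p -> enorm (p - x0) < a / 2 ->
    exists p1, [/\ A p1, g (p1 - dot p1 e *: e) < dot p1 e & enorm (p1 - x0) < a].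
  move=> oA Ap Op pa.
  have [d d0 dA] := nbhs_enormP (open_nbhs_nbhs (conj oA Ap)).
  pose t := Num.min (d / 2) (a / 2).
  have t0 : 0 < t by rewrite lt_min !divr_gt0.
  have td : t <= d / 2 by rewrite ge_min lexx.
  have ta : t <= a / 2 by rewrite ge_min lexx orbT.
  have te : enorm (t *: e) = t by rewrite enormZ (enorm_unit e1) mulr1 gtr0_norm.
  exists (p + t *: e); split.
  - by apply: dA; rewrite addrC addKr te; lra.
  - rewrite orthD orthZ// addr0 dotDl dotZl e1 mulr1.
    have : ~ dot p e < g (p - dot p e *: e).
      by move=> pg; apply: Op; apply/H => //; rewrite /eball/=; lra.
    by move/negP; rewrite -leNgt; lra.
  - by rewrite addrAC; apply: le_lt_trans (enormD _ _) _; rewrite te; lra.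
have [p0 [Ep0 Op0 p0a]] := Ep _ a20; have [q0 [Eq0 Oq0 q0a]] := Eq _ a20.
have [p [Epp gp pa]] := up _ _ oE Ep0 Op0 p0a.
have [q [Eqq gq qa]] := up _ _ (@open_interior _ _) Eq0 Oq0 q0a.
have Op : O p by apply: OP => //; lra.
have Oq : O q by apply: OP => //; lra.
split.
- have [b b0 bO] := nbhs_box (open_nbhs_nbhs (conj (openI oE oO) (conj Epp Op))).
  exists p, b; split => // y /bO[Ey Oy]; split => //; first exact: OO.
  by case: Oy => _ /= yr; lra.
- have [b b0 bO] := nbhs_box (open_nbhs_nbhs (conj (openI (@open_interior _ _) oO) (conj Eqq Oq))).
  exists q, b; split => // y /bO[Ey Oy]; split => //; [exact: interior_subset Ey|exact: OO|].
  by case: Oy => _ /= yr; lra.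
suff [y [bE Oy]] : exists y, boundary E y /\ O y.
  have [d d0 dO] := nbhs_enormP (open_nbhs_nbhs (conj oO Oy)).
  exists y, d; split => //; first by case: Oy => _ /= yr; lra.
  by move=> z /dO/OO.
apply: contrapT => nb.
have seg (u v : 'rV[R]_n) : (forall l : R, 0 <= l <= 1 -> O (u + l *: (v - u))) -> E u -> E v.
  move=> Ouv Eu; apply: contrapT => Ev.
  have [l l01 bl] := segment_boundary oE Eu Ev.
  by apply: nb; exists (u + l *: (v - u)); split => //; exact: Ouv.
have vert (u : 'rV[R]_n) (l : R) : g (u - dot u e *: e) < dot u e -> enorm (u - x0) < a ->
    0 <= l <= r / 2 -> O (u + l *: e).
  move=> gu ua /andP[l0 lr]; apply: OP.
    by rewrite orthD orthZ// addr0 dotDl dotZl e1 mulr1; lra.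
  rewrite addrAC; apply: le_lt_trans (enormD _ _) _.
  by rewrite enormZ (enorm_unit e1) mulr1 ger0_norm//; lra.
have Ep1 : E (p + (r / 2) *: e).
  apply: (seg p) => // l /andP[l0 l1].
  rewrite (_ : _ + l *: _ = p + (l * (r / 2)) *: e); last first.
    by apply/rowP => i; rewrite !mxE; ring.
  apply: vert => //; apply/andP; split.
    by rewrite mulr_ge0// divr_ge0// ltW.
  by rewrite ler_piMl// divr_ge0// ltW.
have Eq1 : E (q + (r / 2) *: e).
  apply: (seg (p + (r / 2) *: e)) => // l /andP[l0 l1].
  rewrite (_ : _ + l *: _ = (p + l *: (q - p)) + (r / 2) *: e); last first.
    by apply/rowP => i; rewrite !mxE; ring.
  set u := p + l *: (q - p).
  have ua : enorm (u - x0) < a.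
    rewrite (_ : u - x0 = (1 - l) *: (p - x0) + l *: (q - x0)); last first.
      by apply/rowP => i; rewrite !mxE; ring.
    apply: le_lt_trans (enormD _ _) _; rewrite !enormZ ger0_norm ?subr_ge0// ger0_norm//.
    apply: (@le_lt_trans _ _ (Num.max (enorm (p - x0)) (enorm (q - x0)))).
      set A := enorm _; set B := enorm _.
      have Am : (1 - l) * A <= (1 - l) * Num.max A B.
        by rewrite ler_wpM2l ?subr_ge0// le_max lexx.
      have Bm : l * B <= l * Num.max A B by rewrite ler_wpM2l// le_max lexx orbT.
      lra.
    by rewrite gt_max pa qa.
  have := gc u (lt_le_trans ua arc); rewrite ltr_distl => /andP[_ gu].
  have := dot_le_unit (u - x0) e1; rewrite dotBl ler_norml => /andP[ud _].
  apply: OP; first by rewrite orthD orthZ// addr0 dotDl dotZl e1 mulr1; lra.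
  rewrite addrAC; apply: le_lt_trans (enormD _ _) _.
  by rewrite enormZ (enorm_unit e1) mulr1 ger0_norm ?divr_ge0 ?ltW//; lra.
have Eq' : E q.
  apply: (seg (q + (r / 2) *: e)) => // l /andP[l0 l1].
  rewrite (_ : _ + l *: _ = q + ((1 - l) * (r / 2)) *: e); last first.
    by apply/rowP => i; rewrite !mxE; ring.
  apply: vert => //; apply/andP; split.
    by rewrite mulr_ge0 ?subr_ge0// divr_ge0// ltW.
  by rewrite ler_piMl//; [rewrite divr_ge0// ltW|lra].
exact: (interior_subset Eqq).
Qed.

End boundary_geometry.

(** * Stationarity against sticking *)

Section free_boundary.
Context {R : realType} {n : nat}.
Implicit Types (E G F Omega : set 'rV[R]_n).

Local Opaque perimeter_integral Per.

Lemma sticking_contradiction (s : R) G Omega (x0 p : 'rV[R]_n) (rho b kappa r0 : R) :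
  0 < s < 1 -> measurable G -> open Omega ->
  (perimeter_integral s G Omega < +oo)%E ->
  0 < rho -> 0 < b -> 0 < kappa -> 0 < r0 ->
  (forall y, Omega y -> enorm (y - x0) < rho -> G y) ->
  (forall y, box p b y -> [/\ G y, ~ Omega y & enorm (y - x0) < rho / 2]) ->
  (forall r, 0 < r < r0 -> exists c, forall y, box c (kappa * r) y ->
     Omega y /\ enorm (y - x0) < 2 * r) ->
  (forall r, 0 < r -> exists y0 e g d, [/\ dot e e = 1, continuous g,
      g (y0 - dot y0 e *: e) = dot y0 e, enorm (y0 - x0) < r & 0 < d] /\
    forall z, enorm (z - y0) < d -> [/\ ~ Omega z,
      dot z e < g (z - dot z e *: e) -> G z & G z -> dot z e <= g (z - dot z e *: e)]) ->
  (forall y0 e delta, dot e e = 1 -> 0 < delta ->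
    (forall z, enorm (z - y0) < 2 * delta -> ~ Omega z) ->
    is_derive (0 : R) (1 : R) (fun t : R => fine (Per s (bump_flow y0 e delta t @` G) Omega)) 0) ->
  False.
Proof.
move=> s01 mG oO Gfin rho0 b0 k0 r00 Grho pb cork graph stat.
have mO := open_measurable_rV oO.
have s0 : 0 < s by case/andP: s01.
have [r rp dec] := sticking_decreases s0 mG mO Gfin rho0 b0 k0 r00 Grho pb cork.
have [|y0 [e [g [d [[e1 cg gy yr d0] loc]]]]] := graph (r / 2); first by rewrite divr_gt0.
pose delta := Num.min (d / 2) (r / 4).
have delta0 : 0 < delta by rewrite lt_min !divr_gt0.
have dd : 2 * delta <= d.
  have : delta <= d / 2 by rewrite ge_min lexx.
  lra.
have dr : 2 * delta <= r / 2.
  have : delta <= r / 4 by rewrite ge_min lexx orbT.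
  lra.
have Oloc z : enorm (z - y0) < 2 * delta -> ~ Omega z.
  by move=> zd; have [] := loc z (lt_le_trans zd dd).
have Glo z : enorm (z - y0) < 2 * delta -> dot z e < g (z - dot z e *: e) -> G z.
  by move=> zd; have [] := loc z (lt_le_trans zd dd).
have Ghi z : enorm (z - y0) < 2 * delta -> G z -> dot z e <= g (z - dot z e *: e).
  by move=> zd; have [] := loc z (lt_le_trans zd dd).
have [w [c [K [w0 c0 rate]]]] := bump_flow_growth_rate e1 delta0 mG cg gy Glo Ghi.
pose f (t : R) := fine (Per s (bump_flow y0 e delta t @` G) Omega).
have [h [hE hc h0]] := (is_derive1_caratheodory f 0 0).1 (stat y0 e delta e1 delta0 Oloc).
pose C : R := @c_ns R n s; have C0 : 0 < C by exact: c_ns_gt0.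
pose m : R := C * w / c; have m0 : 0 < m by rewrite divr_gt0// mulr_gt0.
have [eta eta0 etah] : exists2 eta : R, 0 < eta & forall z, `|z| < eta -> `|h z| < m.
  move/cvgrPdist_lt : hc => /(_ _ m0)/nbhs_ballP[eta eta0 H].
  exists eta => // z zeta; have := H z; rewrite h0 sub0r normrN; apply.
  by rewrite /ball/= sub0r normrN.
have [k kK] : exists k : nat, Num.max K (c / eta) < k.+1%:R.
  by exists (Num.trunc (Num.max K (c / eta))); exact: truncnS_gt.
move: kK; rewrite gt_max => /andP[Kk ck].
have k0' : (0 : R) < k.+1%:R by rewrite ltr0n.
pose t : R := c / k.+1%:R; have t0 : 0 < t by rewrite divr_gt0.
have teta : t < eta.
  by rewrite ltr_pdivrMr// mulrC -ltr_pdivrMr.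
have {}rate := rate k (ltW Kk); rewrite -/t in rate.
set F := bump_flow y0 e delta t @` G in rate.
have mF : measurable F by exact: measurable_bump_flow_image.
have GF : G `<=` F := bump_flow_grows e1 delta0 Glo Ghi (ltW t0).
have FD y : F y -> ~ G y -> ~ Omega y /\ enorm (y - x0) < r.
  move=> Fy Gy; have yd : enorm (y - y0) < 2 * delta.
    rewrite ltNge; apply/negP => yd; apply: Gy.
    by move: Fy; rewrite /F (bump_flow_image _ e1 delta0) /= bump_flow_out.
  split; first exact: Oloc.
  by have := enorm_dist_triangle y0 y x0; lra.
have {}dec := dec F mF GF FD.
have [v vE] : exists v : R, perimeter_integral s G Omega = v%:E.
  exists (fine (perimeter_integral s G Omega)).
  by symmetry; apply: fineK; rewrite (ge0_fin_numE (perimeter_integral_ge0 _ _ _)).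
have [u uE] : exists u : R, perimeter_integral s F Omega = u%:E.
  exists (fine (perimeter_integral s F Omega)).
  symmetry; apply: fineK; rewrite (ge0_fin_numE (perimeter_integral_ge0 _ _ _)).
  by apply: le_lt_trans Gfin; apply: le_trans dec; rewrite leeDl.
rewrite uE vE in dec.
have drop : u + w / k.+1%:R <= v.
  by rewrite -lee_fin EFinD; apply: le_trans dec; exact: leeD2l.
have flow0 : bump_flow y0 e delta 0 @` G = G.
  apply/seteqP; split => [_ [y Gy <-]|y Gy]; first by rewrite bump_flow0.
  by exists y => //; rewrite bump_flow0.
have ft : f t = C * u by rewrite /f PerE uE.
have f0 : f 0 = C * v by rewrite /f flow0 PerE vE.
have := hE t; rewrite subr0 ft f0 => ht.
have := etah t; rewrite (gtr0_norm t0) => /(_ teta); rewrite ltr_norml => /andP[hm _].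
have mt : m * t = C * (w / k.+1%:R).
  by rewrite /m /t; field; rewrite !gt_eqF.
have Cdrop : C * u + m * t <= C * v by rewrite mt -mulrDr ler_pM2l.
have : - m * t < C * u - C * v by rewrite ht ltr_pM2r.
by rewrite mulNr ltrBrDl ltrBlDr ltNge Cdrop.
Qed.

Lemma bump_field_tangent Omega (y0 e : 'rV[R]_n) (delta : R) :
  0 < delta -> (forall z, enorm (z - y0) < 2 * delta -> ~ Omega z) ->
  forall x, boundary Omega x -> tangent_space (boundary Omega) x (bump_field y0 e delta x).
Proof.
move=> delta0 Oloc x bx; rewrite bump_field_out//; last first.
  rewrite leNgt; apply/negP => xd; have [clx _] := bx.
  have : nbhs x [set z | enorm (z - y0) < 2 * delta].
    by apply: open_nbhs_nbhs; split => //; exact/open_lt_fun/continuous_enorm_sub.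
  by move=> /clx[z [Oz /Oloc]].
by exists (fun=> x); split; [|by exists 1 => /=|exact: is_derive_cst].
Qed.

Lemma stationary_bump_flow (s : R) E Omega : free_boundary_minimal s E Omega ->
  forall (y0 e : 'rV[R]_n) delta, dot e e = 1 -> 0 < delta ->
    (forall z, enorm (z - y0) < 2 * delta -> ~ Omega z) ->
    is_derive (0 : R) (1 : R) (fun t : R => fine (Per s (bump_flow y0 e delta t @` E) Omega)) 0.
Proof.
move=> Emin y0 e delta e1 delta0 Oloc.
have [] := Emin (bump_field y0 e delta) (bump_flow y0 e delta) => //.
- exact: smooth_bump_field.
- exact: bump_field_tangent.
- exact: is_flow_bump.
Qed.

Lemma stationary_bump_flowC (s : R) E Omega :
  measurable E -> measurable Omega -> free_boundary_minimal s E Omega ->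
  forall (y0 e : 'rV[R]_n) delta, dot e e = 1 -> 0 < delta ->
    (forall z, enorm (z - y0) < 2 * delta -> ~ Omega z) ->
    is_derive (0 : R) (1 : R)
      (fun t : R => fine (Per s (bump_flow y0 e delta t @` (~` E)) Omega)) 0.
Proof.
move=> mE mO Emin y0 e delta e1 delta0 Oloc.
rewrite (_ : (fun t : R => _) = fun t : R => fine (Per s (bump_flow y0 e delta t @` E) Omega)).
  exact: stationary_bump_flow.
apply/funext => t.
have mF : measurable (bump_flow y0 e delta t @` E) by exact: measurable_bump_flow_image.
have flowC : bump_flow y0 e delta t @` (~` E) = ~` (bump_flow y0 e delta t @` E).
  by rewrite !(bump_flow_image _ e1 delta0) preimage_setC.
by rewrite flowC !PerE (perimeter_integralC s mF mO).
Qed.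

Lemma minimal_perimeter_fin (s : R) E Omega : 0 < s < 1 ->
  free_boundary_minimal s E Omega -> (perimeter_integral s E Omega < +oo)%E.
Proof.
move=> s01 Emin; have [|||/nbhs_singleton] := Emin (fun=> 0) (fun _ x => x).
- split; first by move=> k; exact: class_C_cst.
  rewrite (_ : [set x | _] = set0) ?closure0; first exact: compact0.
  by apply/seteqP; split => // x; rewrite /= eqxx.
- move=> x bx; by exists (fun=> x); split; [|by exists 1 => /=|exact: is_derive_cst].
- by split => // t x; exact: is_derive_cst.
rewrite image_id PerE => Pfin _; rewrite ltey; apply/eqP => Poo; move: Pfin.
by rewrite Poo mulry gtr0_sg ?c_ns_gt0// mul1e.
Qed.

End free_boundary.

Unset Implicit Arguments.
Set Strict Implicit.

Theorem theorem1p17 (R : realType) (n : nat) (s : R) (E Omega : set 'rV[R]_n)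
    (s_bounds : 0 < s < 1)
    (Omega_open : open Omega) (Omega_C1 : set_of_class 1 Omega)
    (E_open : open E) (E_C0 : set_of_class 0 E)
    (E_min : free_boundary_minimal s E Omega) :
  forall x : 'rV[R]_n, (boundary E `&` boundary Omega) x ->
    ~ sticks_from_outside E Omega x.
Proof.
move=> x [bE bO] [rho0 rho00 stick].
have [nu [gO [rO [nu1 CgO rO0 HO]]]] := Omega_C1 x bO.
have [e [gE [rE [e1 cgE rE0 HE]]]] := E_C0 x bE.
have cgO : continuous gO by exact: (class_CW CgO).
have gOx := graph_boundary Omega_open bO cgO rO0 HO.
have gEx := graph_boundary E_open bE cgE rE0 HE.
have [kappa [r0 [kappa0 r00 cork]]] := interior_corkscrew Omega_open bO nu1 CgO rO0 HO.
have mE := open_measurable_rV E_open; have mO := open_measurable_rV Omega_open.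
have Efin := minimal_perimeter_fin s_bounds E_min.
have local y rho : boundary E y -> 0 < rho -> (forall z, enorm (z - y) < rho -> ~ Omega z) ->
    exists (f : 'rV[R]_n) (g : 'rV[R]_n -> R) (d : R), [/\ dot f f = 1, continuous g,
      g (y - dot y f *: f) = dot y f & 0 < d] /\
    forall z, enorm (z - y) < d -> ~ Omega z /\ (E z <-> dot z f < g (z - dot z f *: f)).
  move=> bEy rhop Oy; have [f [g [d [f1 cg d0 H]]]] := E_C0 y bEy.
  exists f, g, (Num.min rho d); split; last first.
    by move=> z; rewrite lt_min => /andP[zr zd]; split; [exact: Oy|exact: H].
  by split => //; [exact: graph_boundary H|rewrite lt_min rhop].
have [inside|outside] := pselect (forall r, 0 < r -> exists rho, [/\ 0 < rho, rho < r &
    Omega `&` eball x rho `<=` E /\ ~` Omega `&` eball x rho `&` E !=set0]).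
  have [rho [rhop _ [OE _]]] := inside 1 ltr01.
  have Grho y : Omega y -> enorm (y - x) < rho -> E y by move=> Oy yr; apply: OE.
  have Ep r : 0 < r -> exists p, [/\ E p, ~ Omega p & enorm (p - x) < r].
    move=> /inside[d [d0 dr [_ [p [[Op pd] Epp]]]]].
    by exists p; split => //; exact: lt_trans pd dr.
  have Eq r : 0 < r -> exists q, [/\ (~` E)° q, ~ Omega q & enorm (q - x) < r].
    move=> rp; have rr : 0 < Num.min r rho by rewrite lt_min rp.
    have [q [Eq qr]] := graph_boundary_epigraph e1 cgE rE0 HE gEx rr.
    move: qr; rewrite lt_min => /andP[qr qrho]; exists q; split => //.
    by move=> Oq; apply: (interior_subset Eq); exact: Grho.
  have pts := boundary_points_outside E_open nu1 cgO rO0 HO gOx Ep Eq.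
  have [|[p [b [b0 pb]]] _ _] := pts (rho / 2); first by rewrite divr_gt0.
  apply: (sticking_contradiction s_bounds mE Omega_open Efin rhop b0 kappa0 r00 Grho pb cork).
    move=> r /pts[_ _ [y [d [bEy yr d0 Oy]]]].
    have [f [g [d' [[f1 cg gy d'0] H]]]] := local y d bEy d0 Oy.
    exists y, f, g, d'; split => // z /H[Oz [Ez1 Ez2]]; split => //.
    by move=> /Ez1/ltW.
  exact: stationary_bump_flow.
have [r1 [r10 nin]] : exists r, 0 < r /\ forall rho, 0 < rho -> rho < r ->
    ~ (Omega `&` eball x rho `<=` E /\ ~` Omega `&` eball x rho `&` E !=set0).
  apply: contrapT => H; apply: outside => r rp; apply: contrapT => H'.
  apply: H; exists r; split => // rho rhop rhor [A B]; apply: H'.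
  by exists rho; split.
have {}stick rho : 0 < rho -> rho < Num.min r1 rho0 ->
    Omega `&` eball x rho `<=` ~` E /\ ~` Omega `&` eball x rho `&` (~` E)° !=set0.
  move=> rhop; rewrite lt_min => /andP[rr1 rr0].
  have [|//|//] := stick rho; first by rewrite rhop.
  by move=> /(nin _ rhop rr1).
have m0 : 0 < Num.min r1 rho0 by rewrite lt_min r10.
pose rho := Num.min r1 rho0 / 2; have rhop : 0 < rho by rewrite divr_gt0.
have rhom : rho < Num.min r1 rho0 by rewrite /rho ltr_pdivrMr//; lra.
have [OE _] := stick rho rhop rhom.
have Grho y : Omega y -> enorm (y - x) < rho -> (~` E) y by move=> Oy yr; apply: OE.
have Ep r : 0 < r -> exists p, [/\ E p, ~ Omega p & enorm (p - x) < r].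
  move=> rp; have rr : 0 < Num.min r rho by rewrite lt_min rp.
  have [clE _] := (open_boundaryE x E_open).1 bE.
  have [p [Epp]] := clE _ (nbhs_enorm x rr).
  rewrite /= lt_min => /andP[pr prho]; exists p; split => //.
  by move=> Op; exact: (Grho p).
have Eq r : 0 < r -> exists q, [/\ (~` E)° q, ~ Omega q & enorm (q - x) < r].
  move=> rp; have rr : 0 < Num.min r rho by rewrite lt_min rp.
  have [||_ [q [[Oq qr] Eq]]] := stick (Num.min r rho) => //.
    by rewrite gt_min rhom orbT.
  by exists q; split => //; move: qr; rewrite /eball /= lt_min => /andP[].
have pts := boundary_points_outside E_open nu1 cgO rO0 HO gOx Ep Eq.
have [|_ [q [b [b0 qb]]] _] := pts (rho / 2); first by rewrite divr_gt0.
have ECfin : (perimeter_integral s (~` E) Omega < +oo)%E by rewrite perimeter_integralC.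
apply: (sticking_contradiction s_bounds (measurableC mE) Omega_open ECfin rhop b0 kappa0 r00 Grho qb cork).
  move=> r /pts[_ _ [y [d [bEy yr d0 Oy]]]].
  have [f [g [d' [[f1 cg gy d'0] H]]]] := local y d bEy d0 Oy.
  have orthN z : z - dot z (- f) *: (- f) = z - dot z f *: f.
    by rewrite dotNr scaleNr scalerN opprK.
  exists y, (- f), (fun v => - g v), d'; split; first split => //.
  - by rewrite dotNl dotNr opprK.
  - by move=> v; exact: (cvgN (cg v)).
  - by rewrite orthN dotNr gy.
  move=> z /H[Oz [Ez1 Ez2]]; rewrite orthN dotNr ltrN2 lerN2; split => //.
    by move=> gz /Ez1; lra.
  by move=> nEz; rewrite leNgt; apply/negP => /Ez2.
exact: stationary_bump_flowC.
Qed.
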